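(* Let $\mathbb{X}$ be a Banach space and let $A$ be the generator of a $C_0$-semigroup on $\mathbb{X}$ which admits an exponential dichotomy. Then there exists $\delta>0$ such that, for every linear operator $B$ on $\mathbb{X}$ that generates a $C_0$-semigroup and satisfies $d_Y(A,B)<\delta$, the $C_0$-semigroup generated by $B$ also has an exponential dichotomy.
   Context: For a linear operator $A$ on a Banach space $\mathbb{X}$ whose resolvent set satisfies $\rho(A)\supset[\omega,\infty)$ for some $\omega$, the Yosida approximation is $A_\lambda:=\lambda^2R(\lambda,A)-\lambda I$ for sufficiently large real $\lambda$, where $R(\lambda,A)=(\lambda I-A)^{-1}$. The Yosida distance between two linear operators $A,B$ on $\mathbb{X}$ with $\rho(A)\supset[\omega,\infty)$ and $\rho(B)\supset[\omega,\infty)$ for some $\omega$ is $d_Y(A,B):=\limsup_{\mu\to+\infty}\|A_\mu-B_\mu\|$ (possibly $+\infty$). A $C_0$-semigroup $(T(t))_{t\ge0}$ on $\mathbb{X}$ admits an exponential dichotomy if there exist a bounded projection $P$ on $\mathbb{X}$ and constants $N\ge1$, $\beta>0$ such that: (1) $T(t)P=PT(t)$ for $t\ge0$; (2) for each $t\ge0$ the restriction $T(t)|_{\ker P}$ is an isomorphism of $\ker P$ onto itself, and $T(-t):=(T(t)|_{\ker P})^{-1}$; (3) $\|T(t)x\|\le Ne^{-\beta t}\|x\|$ for all $t\ge0$, $x\in\mathrm{Im}(P)$, and $\|T(-t)x\|\le Ne^{-\beta t}\|x\|$ for all $t\ge0$, $x\in\ker P$. *)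

(* Defs.v *)
From HB Require Import structures.
From mathcomp Require Import all_boot all_order all_algebra.
From mathcomp Require Import complex.
From mathcomp Require Import all_classical all_reals all_analysis.

Set Implicit Arguments.
Unset Strict Implicit.
Unset Printing Implicit Defensive.

Import Order.TTheory GRing.Theory Num.Theory.
Import numFieldNormedType.Exports.

Local Open Scope classical_set_scope.
Local Open Scope ring_scope.

(* Banach spaces are taken over the real or the complex numbers alike; times,
   the parameter of the Yosida approximation and all constants are real and act
   on the space through [of_real]. *)
Variant scalar_kind := RealScalars | ComplexScalars.

Definition scalar_field (R : realType) (k : scalar_kind) : numFieldType :=
  match k with RealScalars => R | ComplexScalars => R[i] end.

Definition of_real (R : realType) (k : scalar_kind) : R -> scalar_field R k :=
  match k return R -> scalar_field R k with
  | RealScalars => fun x => x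
  | ComplexScalars => fun x => x%:C%C
  end.
Arguments of_real {R k} x.

(* A possibly unbounded operator: [op] is a total function, but only its values
   on the subspace [dom] are meaningful. *)
Record linear_operator (K : numFieldType) (X : lmodType K) := LinearOperator {
  dom : set X ;
  op :> X -> X ;
  dom0 : dom 0 ;
  dom_lin : forall (a : K) x y, dom x -> dom y -> dom (a *: x + y) ;
  op_lin : forall (a : K) x y, dom x -> dom y ->
    op (a *: x + y) = a *: op x + op y }.

Section YosidaDistance.
Context {R : realType} {k : scalar_kind}.
Notation K := (scalar_field R k).
Context {X : normedModType K}.
Implicit Types A B : linear_operator X.

(* The values of [resolvent A l] are junk unless [l] is in the resolvent set. *)
Definition resolvent A (l : K) : X -> X :=
  'pinv_(fun=> 0) (dom A) (fun x => l *: x - A x).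

Definition resolvent_set A : set K :=
  [set l | set_bij (dom A) [set: X] (fun x => l *: x - A x) /\
           continuous (resolvent A l)].

Definition yosida A (l : R) : X -> X :=
  fun x => of_real l ^+ 2 *: resolvent A (of_real l) x - of_real l *: x.

(* Least bound of an operator; it is +oo when there is none. *)
Definition opnorm (f : X -> X) : \bar R :=
  ereal_inf [set M%:E | M in
    [set M : R | 0 <= M /\ forall x, `|f x| <= of_real M * `|x|]].

(* Meaningful when [resolvent_set A] and [resolvent_set B] contain a real
   half-line, which is always the case for generators of C0-semigroups. *)
Definition yosida_distance A B : \bar R :=
  limf_esup (fun mu : R => opnorm (fun x => yosida A mu x - yosida B mu x))
            +oo_R.

End YosidaDistance.

Section Semigroup.
Context {R : realType} {k : scalar_kind}.
Notation K := (scalar_field R k).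
Context {X : normedModType K}.
(* Only the values at nonnegative times are constrained or used. *)
Implicit Types T : R -> {linear X -> X}.

Definition C0_semigroup T : Prop :=
  [/\ forall t : R, 0 <= t -> continuous (T t),
      forall x, T 0 x = x,
      forall (s t : R) x, 0 <= s -> 0 <= t -> T (s + t) x = T s (T t x)
    & forall x, T t x @[t --> 0^'+] --> x].

(* Equality of the graph of [A] with that of the right derivative at 0. *)
Definition generator_of T (A : linear_operator X) : Prop :=
  forall x y, dom A x /\ A x = y <->
    (of_real t)^-1 *: (T t x - x) @[t --> 0^'+] --> y.

Definition ker (P : X -> X) : set X := [set x | P x = 0].

(* The operator written T(-t). *)
Definition backward T (P : X -> X) (t : R) : X -> X :=
  'pinv_(fun=> 0) (ker P) (T t).

(* Boundedness of the inverse of the isomorphism of [ker P] onto itself is the last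
   clause. *)
Definition exponential_dichotomy T : Prop :=
  exists (P : {linear X -> X}) (N beta : R),
    [/\ continuous P /\ (forall x, P (P x) = P x),
        1 <= N /\ 0 < beta,
        forall (t : R) x, 0 <= t -> T t (P x) = P (T t x),
        forall t : R, 0 <= t -> set_bij (ker P) (ker P) (T t)
      & forall t : R, 0 <= t ->
          (forall x, range P x ->
             `|T t x| <= of_real (N * expR (- beta * t)) * `|x|) /\
          (forall x, ker P x ->
             `|backward T P t x| <= of_real (N * expR (- beta * t)) * `|x|)].

End Semigroup.

(* Main.v *)
Require Import Defs.
From HB Require Import structures.
From mathcomp Require Import all_boot all_order all_algebra.
From mathcomp Require Import complex.
From mathcomp Require Import all_classical all_reals all_analysis.
From mathcomp Require Import zify ring lra.
Set Implicit Arguments.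
Unset Strict Implicit.
Unset Printing Implicit Defensive.

Import Order.TTheory GRing.Theory Num.Theory.
Import numFieldNormedType.Exports.
Local Open Scope classical_set_scope.
Local Open Scope ring_scope.

(* Replacing scalars by real ones, X is a real Banach space.  Write R(mu, A) for
   the resolvent.  For u in the domain of B, the curve s |-> T(t-s) R(mu, A) S(s) u
   has derivative T(t-s) (z - R(mu, A) (mu - B) z) with z = S(s) u, and the bracket
   has norm at most delta / mu^2 |(mu - B) z| because z = R(mu, B) (mu - B) z and
   mu^2 (R(mu, A) - R(mu, B)) = A_mu - B_mu.  Multiplying by mu and letting
   mu -> oo gives |S(t) u - T(t) u| <= delta t M sup |S(s) u|, so on a bounded time
   interval S is uniformly close to T when delta is small.

   At a time tau at which T(tau) contracts Im P and expands ker P strongly, closeness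
   makes x(n+1) = S(tau) x(n) + f(n) uniquely solvable in bounded two-sided
   sequences.  If G(w) is the solution for the impulse f = w at n = -1, then
   Q w = G(w)(0) is a projection commuting with every bounded operator that commutes
   with S.  Applying the a priori bound to |n| G(w)(n), cut off at |n| = m, gives
   |G(w)(n)| = O(1/|n|), and hence exponential decay. *)

(** * Real and complex Banach spaces as real ones *)

(** The domains of A and B may differ, so B - A is not an operator to which variation of constants
    applies. The regularised curve replaces it, because R(mu, A) maps into the domain of A.
    Moreover, delta has to be fixed before B is known. The estimate of S - T first involves a bound
    of S, but it returns half of that bound plus a bound of T, so iterating it removes every
    dependence on S. Two-sided sequences are used because they need no spectrum, hence no complex
    scalars, and because closeness of S and T then matters at the single time tau. Since S(t)
    commutes with S(tau), the projection found at tau serves every t. The same commutation, applied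
    to multiplication by a scalar, shows that the projection, built over the reals, is linear over
    the original scalars. Decay in O(1/|n|) suffices, because a factor 1/2 at a single time
    propagates by the semigroup law. *)

Section OfReal.
Context {R : realType} {k : scalar_kind}.
Local Notation K := (scalar_field R k).
Implicit Types a b : R.

Lemma of_real0 : of_real (0 : R) = 0 :> K.
Proof. by case: k. Qed.

Lemma of_real1 : of_real (1 : R) = 1 :> K.
Proof. by case: k. Qed.

Lemma of_realD a b : of_real (a + b) = of_real a + of_real b :> K.
Proof. case: k => //; exact: (rmorphD (real_complex R)). Qed.

Lemma of_realM a b : of_real (a * b) = of_real a * of_real b :> K.
Proof. case: k => //; exact: (rmorphM (real_complex R)). Qed.

Lemma of_realV a : of_real a^-1 = (of_real a)^-1 :> K.
Proof. case: k => //; exact: (fmorphV (real_complex R)). Qed.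

Lemma ler_of_real a b : (of_real a <= of_real b :> K) = (a <= b).
Proof. case: k => //; exact: lecR. Qed.

Lemma ltr_of_real a b : (of_real a < of_real b :> K) = (a < b).
Proof. case: k => //; exact: ltcR. Qed.

Lemma of_real_inj : injective (@of_real R k).
Proof. by move=> a b ab; apply/eqP; rewrite eq_le -!ler_of_real ab lexx. Qed.

Lemma norm_of_real a : `|of_real a : K| = of_real `|a|.
Proof.
by case: k => //; rewrite normc_def /= expr0n addr0 sqrtr_sqr.
Qed.

Definition real_part : K -> R :=
  match k return scalar_field R k -> R with
  | RealScalars => id
  | ComplexScalars => @complex.Re R
  end.

(** The order of [R[i]] compares only numbers with equal imaginary parts, so nonnegative elements
    are real. This makes the [K]-valued norms real numbers. *)
Lemma real_partK (z : K) : 0 <= z -> of_real (real_part z) = z.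
Proof.
rewrite /real_part; case: k z => //= -[x y]; rewrite lecE /= => /andP[/eqP-> _].
by [].
Qed.

End OfReal.

(** A new name for the carrier, so that its structures over [R] do not clash with those over [K]. *)
Definition realified (R : realType) (k : scalar_kind)
  (X : completeNormedModType (scalar_field R k)) : Type := X.

Section Realified.
Context {R : realType} {k : scalar_kind}.
Local Notation K := (scalar_field R k).
Variable X : completeNormedModType K.
Local Notation XR := (realified X).

HB.instance Definition _ := GRing.Zmodule.copy XR X.

Let scale (a : R) (x : XR) : XR := of_real a *: (x : X).

Let scaleA a b v : scale a (scale b v) = scale (a * b) v.
Proof. by rewrite /scale scalerA of_realM. Qed.

Let scale1 : left_id 1 scale.
Proof. by move=> v; rewrite /scale of_real1 scale1r. Qed.

Let scaleDr : right_distributive scale +%R.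
Proof. by move=> a u v; rewrite /scale scalerDr. Qed.

Let scaleDl v : {morph scale^~ v : a b / a + b}.
Proof. by move=> a b; rewrite /scale of_realD scalerDl. Qed.

HB.instance Definition _ := GRing.Zmodule_isLmodule.Build R XR
  scaleA scale1 scaleDr scaleDl.

Let norm (x : XR) : R := real_part (`|x : X|).

Let of_real_norm x : of_real (norm x) = `|x : X|.
Proof. exact: real_partK. Qed.

Let ler_normD x y : norm (x + y) <= norm x + norm y.
Proof.
by rewrite -(@ler_of_real _ k) of_realD !of_real_norm; exact: ler_normD.
Qed.

Let normrZ a x : norm (a *: x) = `|a| * norm x.
Proof.
apply: (@of_real_inj _ k).
by rewrite of_realM !of_real_norm -norm_of_real -normrZ.
Qed.

Let normr0_eq0 x : norm x = 0 -> x = 0.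
Proof.
move=> x0; apply/eqP; rewrite -(@normr_eq0 _ X) -of_real_norm x0.
by rewrite of_real0.
Qed.

HB.instance Definition _ :=
  Lmodule_isNormed.Build R XR ler_normD normrZ normr0_eq0.

Lemma realified_norm (x : XR) : of_real `|x| = `|x : X|.
Proof. exact: of_real_norm. Qed.

Lemma realified_scale (a : R) (x : XR) : a *: x = of_real a *: (x : X).
Proof. by []. Qed.

Lemma cvg_realified (U : Type) (F : set_system U) {FF : Filter F}
    (f : U -> X) (l : X) :
  (f x @[x --> F] --> l) <-> ((f x : XR) @[x --> F] --> (l : XR)).
Proof.
split=> /cvgrPdist_lt cvf; apply/cvgrPdist_lt => e e0.
- have /cvf : 0 < of_real e :> K by rewrite -of_real0 ltr_of_real.
  apply: filterS => x; rewrite -(@ltr_of_real _ k); congr (_ < _).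
  exact/esym/(realified_norm (l - f x)).
- have eE : of_real (real_part e) = e by rewrite real_partK ?ltW.
  have /cvf : 0 < real_part e by rewrite -(@ltr_of_real _ k) of_real0 eE.
  apply: filterS => x; rewrite -(@ltr_of_real _ k) eE; congr (_ < _).
  exact: (realified_norm (l - f x)).
Qed.

Let realified_complete (F : set_system XR) :
  ProperFilter F -> cauchy F -> cvg F.
Proof.
move=> FF Fc.
have /cauchy_cvgP FX : cauchy (F : set_system X).
  apply: cauchy_exP => e e0.
  have eE : of_real (real_part e) = e by rewrite real_partK ?ltW.
  have eR : 0 < real_part e by rewrite -(@ltr_of_real _ k) of_real0 eE.
  have [x xF] := iffLR (cauchyP F) Fc _ eR.
  exists x; move: xF; apply: filterS => y; rewrite -!ball_normE /ball_/=.
  by rewrite -(@ltr_of_real _ k) eE realified_norm.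
move: FX; rewrite cvg_ex => -[l Fl]; apply/cvg_ex; exists (l : XR).
have FF' : Filter F by exact: filter_filter.
exact: (@cvg_realified _ F FF' id l).1 Fl.
Qed.

HB.instance Definition _ := Uniform_isComplete.Build XR realified_complete.

End Realified.

(** * Linear identities *)

(* Reflexive decision of linear identities in a module; the equalities between
   coefficients are left to [ring]. *)
Section LinearIdentities.
Context {R : comPzRingType} {V : lmodType R}.

Inductive lexp : Type :=
  | LVar of nat | LZero | LAdd of lexp & lexp | LOpp of lexp | LScale of R & lexp.

Fixpoint leval (env : seq V) (e : lexp) : V :=
  match e with
  | LVar i => nth 0 env i
  | LZero => 0
  | LAdd a b => leval env a + leval env b
  | LOpp a => - leval env a
  | LScale c a => c *: leval env a
  end.

Fixpoint lcoef (e : lexp) (i : nat) : R :=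
  match e with
  | LVar j => if (j == i)%N then 1 else 0
  | LZero => 0
  | LAdd a b => lcoef a i + lcoef b i
  | LOpp a => - lcoef a i
  | LScale c a => c * lcoef a i
  end.

Lemma levalE env e :
  leval env e = \sum_(i < size env) lcoef e i *: nth 0 env i.
Proof.
elim: e => [j||a IHa b IHb|a IHa|c a IHa] /=.
- have [jn|jn] := ltnP j (size env); last first.
    rewrite nth_default// big1// => i _; case: eqP => [ji|_]; last exact: scale0r.
    by move: jn; rewrite ji leqNgt ltn_ord.
  rewrite (bigD1 (Ordinal jn))//= eqxx scale1r big1 ?addr0// => i.
  by rewrite -val_eqE/= eq_sym => /negPf ->; rewrite scale0r.
- by rewrite big1// => i _; rewrite scale0r.
- by rewrite IHa IHb -big_split; apply: eq_bigr => i _; rewrite scalerDl.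
- by rewrite IHa -sumrN; apply: eq_bigr => i _; rewrite scaleNr.
- by rewrite IHa scaler_sumr; apply: eq_bigr => i _; rewrite scalerA.
Qed.

Fixpoint lcoef_eq (a b : lexp) (n : nat) : Prop :=
  if n is m.+1 then lcoef a m = lcoef b m /\ lcoef_eq a b m else True.

Lemma leval_eq env a b : lcoef_eq a b (size env) -> leval env a = leval env b.
Proof.
move=> ab; rewrite !levalE; apply: eq_bigr => -[i ni] _ /=; congr (_ *: _).
elim: (size env) ni ab => // n IHn; rewrite ltnS leq_eqVlt => ni [abn ab].
by case/orP: ni => [/eqP ->//|ni]; exact: IHn.
Qed.

End LinearIdentities.

(* Atoms are compared up to conversion: the same operation may occur through
   different paths of the algebraic hierarchy. *)
Ltac same_atom x y :=
  match goal with
  | _ => let _ := match goal with _ => unify x y end in constr:(true)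
  | _ => constr:(false)
  end.

Ltac index_env x env :=
  match env with
  | x :: _ => constr:(Some 0%N)
  | ?y :: ?t =>
    let b := same_atom x y in
    match b with
    | true => constr:(Some 0%N)
    | false => let n := index_env x t in
      match n with Some ?n => constr:(Some (S n)) | None => constr:(@None nat) end
    end
  | _ => constr:(@None nat)
  end.

Ltac add_env x env :=
  let n := index_env x env in
  match n with Some _ => env | None => constr:(x :: env) end.

Ltac lmod_atoms e env :=
  match e with
  | 0 => env
  | (?a + ?b)%R => let env := lmod_atoms a env in lmod_atoms b env
  | (- ?a)%R => lmod_atoms a env
  | (_ *: ?a)%R => lmod_atoms a env
  | ?x => add_env x env
  end.

Ltac lmod_reify R e env :=
  match e with
  | 0 => constr:(@LZero R)
  | (?a + ?b)%R =>
      let a := lmod_reify R a env in let b := lmod_reify R b env in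
      constr:(@LAdd R a b)
  | (- ?a)%R => let a := lmod_reify R a env in constr:(@LOpp R a)
  | (?c *: ?a)%R => let a := lmod_reify R a env in constr:(@LScale R c a)
  | ?x => let i := index_env x env in
    match i with Some ?i => constr:(@LVar R i) end
  end.

Ltac lmod R :=
  match goal with |- @eq ?V ?l ?r =>
    let env := lmod_atoms l (@nil V) in
    let env := lmod_atoms r env in
    let a := lmod_reify R l env in
    let b := lmod_reify R r env in
    apply: (@leval_eq _ _ env a b); rewrite /=;
    repeat (split; first by ring); exact: I
  end.

(** * Mean value inequality and antiderivatives *)

Section Limits.
Context {R : realType} {X : completeNormedModType R}.

Lemma cauchy_rate_limit (u : nat -> X) (r : nat -> R) :
  (forall e, 0 < e -> exists n, r n < e) ->
  (forall m n, (m <= n)%N -> `|u n - u m| <= r m) ->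
  exists l, forall n, `|l - u n| <= r n.
Proof.
move=> r0 ur.
have : cvg (u @ \oo).
  apply/cauchy_cvgP/cauchy_exP => e e0; have [n rn] := r0 _ e0.
  exists (u n); exists n => // m /= nm; rewrite -ball_normE /ball_/= distrC.
  exact: le_lt_trans (ur _ _ nm) rn.
move=> /cvg_ex[l ul]; exists l => n; apply/ler_addgt0Pr => e e0.
have /cvgrPdist_le/(_ _ e0)[N _ Nu] := ul.
have := Nu (maxn n N) (leq_maxr _ _); have := ur _ _ (leq_maxl n N) => /= a b.
have := ler_distD (u (maxn n N)) l (u n); lra.
Qed.

Lemma pow_half_lt (C e : R) : 0 < e -> exists n, C * 2^-1 ^+ n < e.
Proof.
move=> e0; have [C0|C0] := leP C 0.
  by exists 0%N; rewrite expr0; lra.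
pose n := (Num.truncn (C / e)).+1.
have nCe : C / e < n%:R by rewrite /n truncnS_gt// divr_ge0// ltW.
exists n; rewrite exprVn ltr_pdivrMr ?exprn_gt0// mulrC.
rewrite ltr_pdivrMr// in nCe; apply: lt_trans nCe _.
by rewrite ltr_pM2r// -natrX ltr_nat ltn_expl.
Qed.

Lemma geometric_limit (u : nat -> X) (C : R) :
  (forall n, `|u n.+1 - u n| <= C * 2^-1 ^+ n) ->
  exists l, forall n, `|l - u n| <= 2 * C * 2^-1 ^+ n.
Proof.
move=> uC; apply: cauchy_rate_limit => [e /pow_half_lt//|m n].
have C0 : 0 <= C by have := uC 0%N; rewrite expr0 mulr1; exact: le_trans.
move=> /subnK <-; elim: (n - m)%N => [|j IHj].
  by rewrite subrr normr0 !mulr_ge0// exprn_ge0.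
suff: `|u (j + m)%N - u m| <= 2 * C * (2^-1 ^+ m - 2^-1 ^+ (j + m)).
  have := uC (j + m)%N; have := ler_distD (u (j + m)%N) (u (j.+1 + m)%N) (u m).
  have : 0 <= C * 2^-1 ^+ (j + m) by rewrite mulr_ge0// exprn_ge0.
  by rewrite addSn; lra.
elim: j {IHj} => [|j IHj]; first by rewrite !subrr normr0 mulr0.
have := uC (j + m)%N; have := ler_distD (u (j + m)%N) (u (j.+1 + m)%N) (u m).
by rewrite addSn [2^-1 ^+ _.+1]exprS; lra.
Qed.

End Limits.

Lemma near_right0 {R : realType} (P : R -> Prop) :
  (\forall h \near 0^'+, P h) ->
  exists2 d, 0 < d & forall h, 0 < h -> h < d -> P h.
Proof.
move=> [d /= d0 dP]; exists d => // h h0 hd; apply: dP => //=.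
by rewrite sub0r normrN gtr0_norm.
Qed.

Section MeanValue.
Context {R : realType} {X : normedModType R}.
Implicit Types (f : R -> X) (a b c : R).

Definition left_continuous f s :=
  forall e, 0 < e -> \forall h \near (0 : R)^'+, `|f (s - h) - f s| <= e.

Definition right_derivative f s (y : X) :=
  forall e, 0 < e ->
  \forall h \near (0 : R)^'+, `|f (s + h) - f s - h *: y| <= e * h.

(** The data are one-sided because a generator is a right derivative. Let s be the supremum of the
    points up to which the estimate with slope c + e holds: left continuity keeps the estimate at s,
    and the increment bound carries it beyond s unless s = b. *)
Lemma mean_value_right f a b c : a <= b ->
  (forall s, a < s <= b -> left_continuous f s) ->
  (forall s, a <= s < b -> forall e, 0 < e ->
     \forall h \near (0 : R)^'+, `|f (s + h) - f s| <= (c + e) * h) ->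
  `|f b - f a| <= c * (b - a).
Proof.
move=> ab fl fr.
have [<-|aNb] := eqVneq a b; first by rewrite !subrr normr0 mulr0.
have altb : a < b by rewrite lt_neqAle aNb.
apply/ler_addgt0Pr => e0 e0_gt0.
pose e := e0 / (b - a).
have ba : 0 < b - a by lra.
have e_gt0 : 0 < e by rewrite divr_gt0.
(* The sign of c is unknown, but c + e times a positive step bounds a norm. *)
have ce : 0 <= c + e.
  have [|d d0 /(_ (d / 2))] := near_right0 (fr a _ _ e_gt0).
    by rewrite lexx.
  have d2 : 0 < d / 2 by lra.
  move=> /(_ d2 ltac:(lra)) fd; rewrite -(pmulr_lge0 _ d2).
  exact: le_trans (normr_ge0 _) fd.
pose E := [set s | a <= s <= b /\ `|f s - f a| <= (c + e) * (s - a)].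
have Ea : E a by split; [rewrite lexx|rewrite !subrr normr0 mulr0].
have Eb : ubound E b by move=> s [/andP[]].
have supE : has_sup E by split; [exists a|exists b].
pose s := sup E.
have as_ : a <= s by apply: ub_le_sup => //; exists b.
have sb : s <= b by apply: ge_sup => //; exists a.
have Es : E s.
  split; first by rewrite as_.
  apply/ler_addgt0Pr => d d0.
  have [aEs|aNs] := eqVneq a s; first by rewrite -aEs !subrr normr0 mulr0; lra.
  have alts : a < s by rewrite lt_neqAle as_ andbT.
  have [|r r0 fsr] := near_right0 (fl s _ _ d0); first by rewrite alts.
  have [t Et st] := sup_adherent r0 supE.
  have ts : t <= s by apply: ub_le_sup => //; exists b.
  case: Et => atb; have := ler_distD (f t) (f s) (f a).
  have : (c + e) * (t - a) <= (c + e) * (s - a) by rewrite ler_wpM2l// lerD2r.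
  have [->|tNs] := eqVneq t s; first by lra.
  have tlts : t < s by rewrite lt_neqAle tNs.
  have := fsr (s - t); rewrite subKr [`|f t - f s|]distrC -/s; move: st;
    rewrite -/s => st.
  by move=> /(_ ltac:(lra) ltac:(lra)); lra.
have [sE|sNb] := eqVneq s b.
  move: Es; rewrite sE => -[_] /le_trans; apply.
  by rewrite mulrDl /e divfK ?gt_eqF.
have sltb : s < b by rewrite lt_neqAle sNb.
have [|r r0 fsr] := near_right0 (fr s _ _ e_gt0); first by rewrite as_.
pose h := Num.min (r / 2) (b - s).
have h0 : 0 < h by rewrite lt_min; apply/andP; split; lra.
have hr : h <= r / 2 by rewrite ge_min lexx.
have hb : h <= b - s by rewrite ge_min lexx orbT.
have : s + h <= s.
  apply: ub_le_sup; first by exists b.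
  split; first by apply/andP; split; lra.
  have := fsr h h0 ltac:(lra); have := ler_distD (f s) (f (s + h)) (f a).
  by case: Es => _; lra.
lra.
Qed.
End MeanValue.

Section Antiderivative.
Context {R : realType} {X : completeNormedModType R}.
Implicit Types (f F : R -> X).

Definition lipschitz_on F a b C := forall s t, a <= s -> s <= t -> t <= b ->
  `|F t - F s| <= C * (t - s).

Lemma lipschitz_left_continuous F a b C s : lipschitz_on F a b C ->
  a < s <= b -> left_continuous F s.
Proof.
move=> FC /andP[as_ sb] e e0.
have C1 : 0 < `|C| + 1 by have := normr_ge0 C; lra.
have d0 : 0 < e / (`|C| + 1) by rewrite divr_gt0.
near=> h.
have h0 : 0 < h by near: h; exact: nbhs_right_gt.
have hs : h < s - a by near: h; apply: nbhs_right_lt; lra.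
have he : h < e / (`|C| + 1) by near: h; exact: nbhs_right_lt.
rewrite distrC; apply: (le_trans (FC _ _ _ _ _)); [lra..|].
rewrite opprB addrCA subrr addr0; rewrite ltr_pdivlMr// in he.
by have := ler_norm C; nra.
Unshelve. all: by end_near. Qed.

(** On each cell of length d the slope is the value of f at the left end, which is within e of f on
    the whole cell. The induction adds one cell at a time. *)
Lemma euler_polygon f d C e n : 0 < d -> 0 <= e ->
  (forall s, 0 <= s <= n%:R * d -> `|f s| <= C) ->
  (forall s t, 0 <= s -> s <= t -> t <= n%:R * d -> t - s <= d ->
     `|f t - f s| <= e) ->
  exists F, [/\ F 0 = 0, lipschitz_on F 0 (n%:R * d) C &
    forall s, 0 <= s < n%:R * d ->
    \forall h \near (0 : R)^'+, `|F (s + h) - F s - h *: f s| <= e * h].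
Proof.
move=> d0 e0; elim: n => [|n IHn] fC fe.
  exists (fun=> 0); split => //.
    move=> s t s0 st; rewrite mul0r => t0.
    by rewrite subrr normr0 (_ : t - s = 0) ?mulr0//; lra.
  by move=> s; rewrite mul0r; lra.
have ndE : n.+1%:R * d = n%:R * d + d by rewrite -addn1 natrD mulrDl mul1r.
have nd0 : 0 <= n%:R * d by rewrite mulr_ge0 ?ler0n// ltW.
rewrite ndE in fC fe *; set nd := n%:R * d in IHn ndE nd0 fC fe *.
have [||G [G0 GC Ge]] := IHn.
- by move=> s ?; apply: fC; lra.
- by move=> s t *; apply: fe; lra.
have fndC : `|f nd| <= C by apply: fC; lra.
pose F t := if t <= nd then G t else G nd + (t - nd) *: f nd.
have Fr t : nd <= t -> F t = G nd + (t - nd) *: f nd.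
  rewrite /F le_eqVlt => /predU1P[<-|]; last by rewrite ltNge => /negPf->.
  by rewrite lexx subrr scale0r addr0.
have Fl t : t <= nd -> F t = G t by rewrite /F => ->.
exists F; split; first by rewrite Fl.
  move=> s t s0 st tnd.
  have [tn|nt] := leP t nd; first by rewrite !Fl//; [exact: GC|lra].
  rewrite (Fr t (ltW nt)).
  have [sn|ns] := leP s nd.
    rewrite Fl// (_ : _ - _ = (G nd - G s) + (t - nd) *: f nd); last by lmod R.
    apply: (le_trans (ler_normD _ _)).
    rewrite normrZ (ger0_norm (_ : 0 <= t - nd)); last lra.
    have := GC s nd s0 sn (lexx _); have : 0 <= t - nd by lra.
    by nra.
  rewrite (Fr s (ltW ns)) (_ : _ - _ = (t - s) *: f nd); last by lmod R.
  by rewrite normrZ (ger0_norm (_ : 0 <= t - s)); [nra|lra].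
move=> s /andP[s0 snd].
have [sn|ns] := ltP s nd.
  near=> h.
  have h0 : 0 < h by near: h; exact: nbhs_right_gt.
  have hn : h < nd - s by near: h; apply: nbhs_right_lt; lra.
  rewrite (Fl s (ltW sn)) (Fl (s + h)); last by lra.
  by near: h; apply: Ge; rewrite s0.
near=> h.
have h0 : 0 < h by near: h; exact: nbhs_right_gt.
rewrite !Fr//; last by lra.
rewrite (_ : _ - _ - _ = h *: (f nd - f s)); last by lmod R.
rewrite normrZ gtr0_norm// mulrC ler_wpM2r ?(ltW h0)// distrC.
by apply: fe; lra.
Unshelve. all: by end_near. Qed.

Lemma ler_pow_half (x y c : R) : (forall n, x <= y + c * 2^-1 ^+ n) -> x <= y.
Proof.
move=> xy; apply/ler_addgt0Pr => e /(pow_half_lt c)[n ce].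
by apply: le_trans (xy n) _; rewrite lerD2l ltW.
Qed.

(** Plays the role of the Riemann integral. Euler polygons with slope errors 2^-n form a uniform
    Cauchy sequence by the mean value inequality applied to their differences. *)
Lemma antiderivative f b C : 0 < b -> (forall s, 0 <= s <= b -> `|f s| <= C) ->
  (forall e, 0 < e -> exists2 d, 0 < d &
     forall s t, 0 <= s -> s <= t -> t <= b -> t - s <= d -> `|f t - f s| <= e) ->
  exists F, [/\ F 0 = 0, lipschitz_on F 0 b C &
    forall s, 0 <= s < b -> right_derivative F s (f s)].
Proof.
move=> b0 fC fu.
pose r n : R := 2^-1 ^+ n.
have r0 n : 0 < r n by rewrite exprn_gt0.
have rle m n : (m <= n)%N -> r n <= r m by move=> mn; rewrite ler_wiXn2l//; lra.
have /choice[F FP] : forall n, exists F, [/\ F 0 = 0, lipschitz_on F 0 b C &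
    forall s, 0 <= s < b ->
    \forall h \near (0 : R)^'+, `|F (s + h) - F s - h *: f s| <= r n * h].
  move=> n; have [d d0 fd] := fu _ (r0 n).
  pose k := (Num.truncn (b / d)).+1.
  have k0 : 0 < k%:R :> R by rewrite ltr0n.
  have kb : k%:R * (b / k%:R) = b by rewrite mulrC divfK// gt_eqF.
  have bkd : b / k%:R <= d.
    rewrite ler_pdivrMr// mulrC -ler_pdivrMr// ltW//.
    by rewrite truncnS_gt.
  have := @euler_polygon f (b / k%:R) C (r n) k; rewrite kb; apply => //.
  - by rewrite divr_gt0.
  - exact: ltW.
  - by move=> s t s0 st tb ts; apply: fd => //; exact: le_trans bkd.
have Fcauchy t : 0 <= t <= b -> forall m n, (m <= n)%N ->
    `|F n t - F m t| <= (2 * b) * r m.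
  move=> /andP[t0 tb] m n mn.
  have [Fn0 FnC Fnf] := FP n; have [Fm0 FmC Fmf] := FP m.
  have := @mean_value_right _ _ (fun s => F n s - F m s) 0 t (r n + r m) t0.
  rewrite /= Fn0 Fm0 !subr0 => mvt.
  apply: (@le_trans _ _ ((r n + r m) * t)); last first.
    by have := rle _ _ mn; have := r0 m; have := r0 n; nra.
  apply: mvt => [s /andP[s0 st]|s /andP[s0 st] e e0].
    have C2 : lipschitz_on (fun s => F n s - F m s) 0 b (C + C).
      move=> u v u0 uv vb /=; have := FnC u v u0 uv vb; have := FmC u v u0 uv vb.
      rewrite (_ : _ - _ - _ = (F n v - F n u) - (F m v - F m u)); last by lmod R.
      by have := ler_normB (F n v - F n u) (F m v - F m u); lra.
    by apply: (lipschitz_left_continuous C2) => //; lra.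
  near=> h.
  have h0 : 0 < h by near: h; exact: nbhs_right_gt.
  rewrite (_ : _ - _ - _ = (F n (s + h) - F n s - h *: f s) -
    (F m (s + h) - F m s - h *: f s)); last by lmod R.
  apply: (le_trans (ler_normB _ _)).
  apply: (@le_trans _ _ (r n * h + r m * h)); last by nra.
  by apply: lerD; near: h; [apply: Fnf|apply: Fmf]; lra.
have /choice[G GP] : forall t, exists l, 0 <= t <= b ->
    forall n, `|l - F n t| <= (2 * b) * r n.
  move=> t; have [tb|tb] := boolP (0 <= t <= b); last by exists 0.
  have [|l lP] := @cauchy_rate_limit _ _ (F ^~ t)
    (fun n => 2 * b * r n) _ (Fcauchy t tb).
    by move=> e; exact: pow_half_lt.
  by exists l.
exists G; split.
- apply/eqP; rewrite -normr_eq0 -normr_le0;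
    apply: (@ler_pow_half _ _ (2 * b)) => n.
  have [F0 _ _] := FP n.
  have h0b : 0 <= (0 : R) <= b by rewrite lexx ltW.
  by rewrite add0r; have := GP 0 h0b n; rewrite F0 subr0 normr_id.
- move=> s t s0 st tb; apply: (@ler_pow_half _ _ (4 * b)) => n.
  have [_ FC _] := FP n; have := FC s t s0 st tb.
  have := GP s ltac:(lra) n; have := GP t ltac:(lra) n.
  have := ler_distD (F n t) (G t) (G s); have := ler_distD (F n s) (F n t) (G s).
  by rewrite (distrC (F n s) (G s)) -/(r n); lra.
move=> s /andP[s0 sb] e e0.
have [d d0 fd] := fu (e / 2) ltac:(lra).
near=> h.
have h0 : 0 < h by near: h; exact: nbhs_right_gt.
have hd : h < d by near: h; exact: nbhs_right_lt.
have hb : h < b - s by near: h; apply: nbhs_right_lt; lra.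
apply: (@le_trans _ _ ((e / 2) * h)); last by nra.
(* With h fixed, n tends to infinity: replacing G by F n costs 2 b r_n at each end of the step, and
   the slope error of F n costs r_n h. *)
apply: (@ler_pow_half _ _ (4 * b + h)) => n.
have [_ FC Fe] := FP n.
have : `|F n (s + h) - (s + h) *: f s - (F n s - s *: f s)| <=
  (r n + e / 2) * (s + h - s).
  apply: (@mean_value_right _ _ (fun u => F n u - u *: f s)); first lra.
    move=> u /andP[su us].
    have C2 : lipschitz_on (fun u => F n u - u *: f s) 0 b (C + C).
      move=> v w v0 vw wb /=; have := FC v w v0 vw wb.
      rewrite (_ : _ - _ - _ = (F n w - F n v) - (w - v) *: f s); last by lmod R.
      have := ler_normB (F n w - F n v) ((w - v) *: f s).
      rewrite normrZ (ger0_norm (_ : 0 <= w - v)); last lra.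
      by have := fC s ltac:(lra); nra.
    by apply: (lipschitz_left_continuous C2) => //; lra.
  move=> u /andP[su us] e1 e10.
  near=> h1.
  have h10 : 0 < h1 by near: h1; exact: nbhs_right_gt.
  rewrite (_ : _ - _ - _ = (F n (u + h1) - F n u - h1 *: f u) +
    h1 *: (f u - f s)); last by lmod R.
  apply: (le_trans (ler_normD _ _)); rewrite normrZ gtr0_norm//.
  have : `|f u - f s| <= e / 2 by apply: fd; lra.
  have : `|F n (u + h1) - F n u - h1 *: f u| <= r n * h1.
    by near: h1; apply: Fe; lra.
  by nra.
rewrite (_ : _ - _ - _ = F n (s + h) - F n s - h *: f s); last by lmod R.
have := GP s ltac:(lra) n; have := GP (s + h) ltac:(lra) n.
rewrite (_ : G (s + h) - _ - _ = (G (s + h) - F n (s + h)) - (G s - F n s) +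
  (F n (s + h) - F n s - h *: f s)); last by lmod R.
have := ler_normD (G (s + h) - F n (s + h) - (G s - F n s))
  (F n (s + h) - F n s - h *: f s).
have := ler_normB (G (s + h) - F n (s + h)) (G s - F n s).
by rewrite -/(r n); nra.
Unshelve. all: by end_near. Qed.

End Antiderivative.

(** * Strongly continuous semigroups and resolvents *)

Section Semigroups.
Context {R : realType} {X : completeNormedModType R}.
Implicit Types (T : R -> {linear X -> X}) (x y z : X).

Lemma linear_unit_ball_bound (f : {linear X -> X}) M :
  (forall x, `|x| <= 1 -> `|f x| <= M) -> forall x, `|f x| <= M * `|x|.
Proof.
move=> fM x; have [->|x0] := eqVneq x 0; first by rewrite linear0 !normr0 mulr0.
have xg0 : 0 < `|x| by rewrite normr_gt0.
have := fM (`|x|^-1 *: x); rewrite linearZ !normrZ normfV normr_id.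
rewrite mulVf ?gt_eqF// lexx => /(_ isT).
by rewrite ler_pdivrMl// mulrC.
Qed.

(** Otherwise there are times u n < 1/(n+1) at which T (u n) violates the bound n+1. Since T (u n) x
    tends to x, this family is pointwise bounded, against Banach-Steinhaus. *)
Lemma strongly_continuous_bounded_near0 T :
  (forall t, 0 <= t -> exists2 M, 0 <= M & forall x, `|T t x| <= M * `|x|) ->
  (forall x, T t x @[t --> 0^'+] --> x) ->
  exists d M, [/\ 0 < d, 1 <= M &
    forall t x, 0 < t -> t < d -> `|T t x| <= M * `|x|].
Proof.
move=> Tc T0; apply: contrapT => noM.
have /choice[u uP] n : exists t, [/\ 0 < t, t < n.+1%:R^-1 &
    ~ forall x, `|T t x| <= n.+1%:R * `|x|].
  apply: contrapT => un; apply: noM; exists n.+1%:R^-1, n.+1%:R; split => //.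
    by rewrite ler1n.
  move=> t x t0 tn; apply: contrapT => Tx; apply: un; exists t; split => //.
pose F := [set (T (u n) : X -> X) | n in [set: nat]].
have [||M FM] := @Banach_Steinhauss _ _ _ F _ _ 1.
- move=> _ [n _ <-]; split; last by move=> a x y; rewrite linearP.
  have [u0 _ _] := uP n.
  have [M M0 TM] := Tc _ (ltW u0).
  move=> r; exists (M * r) => x xr; apply: le_trans (TM x) _.
  by rewrite ler_wpM2l.
- move=> x; have [d d0 Td] := near_right0 ((@cvgrPdist_le _ _ _ _ _ _ _).1
    (T0 x) 1 ltr01).
  have [N Nd] : exists N, forall n, (N <= n)%N -> n.+1%:R^-1 < d.
    exists (Num.truncn d^-1) => n Nn; rewrite invf_plt ?posrE//.
    apply: lt_le_trans (truncnS_gt _) _; by rewrite ler_nat.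
  (* The tail is within 1 of x, and the sum covers the finitely many other terms. *)
  exists (`|x| + 1 + \sum_(i < N) `|T (u i) x|) => _ [n _ <-].
  have S0 : 0 <= \sum_(i < N) `|T (u i) x| by rewrite sumr_ge0.
  have [nN|Nn] := ltnP n N.
    rewrite (bigD1 (Ordinal nN))//=.
    have : 0 <= \sum_(i < N | i != Ordinal nN) `|T (u i) x| by rewrite sumr_ge0.
    by have := normr_ge0 x; lra.
  have [u0 un _] := uP n.
  have := Td _ u0 (lt_trans un (Nd _ Nn)).
  by have := ler_distD 0 (T (u n) x) x; rewrite !subr0 sub0r normrN;
    have := lerB_dist (T (u n) x) x; rewrite distrC; lra.
pose n := Num.truncn `|M|.
have [u0 un nTu] := uP n; apply: nTu => x.
apply: le_trans (linear_unit_ball_bound _ x) _.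
  by move=> y y1; apply: FM y1; exists n.
rewrite ler_wpM2r//; apply: le_trans (ler_norm _) _; apply/ltW.
exact: truncnS_gt.
Qed.

(** Local uniform boundedness, a consequence of Banach-Steinhaus, is built in because every later
    estimate uses it. *)
Definition strong_semigroup T : Prop :=
  [/\ forall x, T 0 x = x,
      forall s t x, 0 <= s -> 0 <= t -> T (s + t) x = T s (T t x),
      forall x e, 0 < e -> \forall h \near (0 : R)^'+, `|T h x - x| <= e
    & forall a, exists2 M, 1 <= M &
        forall t x, 0 <= t -> t <= a -> `|T t x| <= M * `|x|].

Lemma strong_semigroupP T :
  (forall t, 0 <= t -> exists2 M, 0 <= M & forall x, `|T t x| <= M * `|x|) ->
    (forall x, T 0 x = x) ->
  (forall s t x, 0 <= s -> 0 <= t -> T (s + t) x = T s (T t x)) ->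
  (forall x, T t x @[t --> 0^'+] --> x) -> strong_semigroup T.
Proof.
move=> Tc T0 TD Tcv; split => //.
  move=> x e e0; have /cvgrPdist_le/(_ _ e0) := Tcv x.
  by apply: filterS => h; rewrite distrC.
have [d [M [d0 M1 TM]]] := strongly_continuous_bounded_near0 Tc Tcv.
(* Steps of length d / 2, since the bound near 0 holds only for t < d. *)
have TMn n : forall t x, 0 <= t -> t <= n%:R * (d / 2) ->
  `|T t x| <= M ^+ n * `|x|.
  elim: n => [|n IHn] t x t0.
    rewrite mul0r => tle0; have -> : t = 0 by apply/eqP; rewrite eq_le t0 tle0.
    by rewrite T0 expr0 mul1r.
  rewrite -addn1 natrD mulrDl mul1r => tn.
  have n0 : 0 <= n%:R * (d / 2) by rewrite mulr_ge0 ?ler0n//; lra.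
  have [td|dt] := ltP t d.
    apply: (@le_trans _ _ (M * `|x|)).
      move: t0; rewrite le_eqVlt => /predU1P[<-|t0]; last exact: TM.
      by rewrite T0 ler_peMl.
    by rewrite ler_wpM2r// addn1 exprS ler_peMr ?exprn_ege1//; lra.
  have -> : t = d / 2 + (t - d / 2) by lra.
  rewrite TD; [|lra..]; apply: (le_trans (TM _ _ _ _)); [lra..|].
  by rewrite addn1 exprS -mulrA ler_wpM2l; [|lra|apply: IHn; lra].
move=> a; pose n := (Num.truncn (a / (d / 2))).+1.
exists (M ^+ n); first by rewrite exprn_ege1.
move=> t x t0 ta; apply: TMn => //; apply: le_trans ta _.
by rewrite -ler_pdivrMr; [exact/ltW/truncnS_gt|lra].
Qed.

End Semigroups.

Section Generators.
Context {R : realType} {X : completeNormedModType R}.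
Implicit Types (T : R -> {linear X -> X}) (x y z : X) (mu : R).

(** The graph of the generator, with the difference quotient multiplied by h. As a relation it
    avoids choosing an operator and its domain. *)
Definition generates T x y : Prop := forall e, 0 < e ->
  \forall h \near (0 : R)^'+, `|T h x - x - h *: y| <= e * h.

Lemma generates_lin T a x y x' y' : generates T x y -> generates T x' y' ->
  generates T (a *: x + x') (a *: y + y').
Proof.
move=> Txy Txy' e e0.
have a1 : 0 < `|a| + 1 by have := normr_ge0 a; lra.
have ea : 0 < e / 2 / (`|a| + 1) by rewrite !divr_gt0.
near=> h.
have h0 : 0 < h by near: h; exact: nbhs_right_gt.
rewrite linearP (_ : _ - _ - _ = a *: (T h x - x - h *: y) +
  (T h x' - x' - h *: y'));
  last by lmod R.
apply: (le_trans (ler_normD _ _)); rewrite normrZ.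
have : `|T h x - x - h *: y| <= e / 2 / (`|a| + 1) * h by near: h; exact: Txy.
have : `|T h x' - x' - h *: y'| <= e / 2 * h.
  by near: h; apply: Txy'; lra.
set u := `|T h x - x - h *: y| => A /(ler_wpM2l (normr_ge0 a)).
have : `|a| * (e / 2 / (`|a| + 1) * h) <= e / 2 * h.
  rewrite mulrA ler_wpM2r ?(ltW h0)// mulrC mulrAC ler_pdivrMr// ler_wpM2l//.
    by lra.
  by lra.
by lra.
Unshelve. all: by end_near. Qed.

Lemma generates_orbit T s x y : strong_semigroup T -> 0 <= s ->
  generates T x y -> generates T (T s x) (T s y).
Proof.
move=> [_ TD _ /(_ s)[M M1 TM]] s0 Txy e e0.
have M0 : 0 < M by lra.
near=> h.
have h0 : 0 < h by near: h; exact: nbhs_right_gt.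
rewrite -TD ?(ltW h0)// (addrC h s) TD ?(ltW h0)// -linearZ -!linearB.
apply: (le_trans (TM _ _ s0 (lexx _))); rewrite -ler_pdivlMl// mulrA.
by near: h; apply: Txy; rewrite mulr_gt0// invr_gt0.
Unshelve. all: by end_near. Qed.

Lemma orbit_right_derivative T s x y : strong_semigroup T -> 0 <= s ->
  generates T x y -> right_derivative (T ^~ x) s (T s y).
Proof.
move=> sgT s0 Txy e e0; have [_ TD _ _] := sgT.
near=> h.
have h0 : 0 < h by near: h; exact: nbhs_right_gt.
rewrite (addrC s h) TD ?(ltW h0)//.
by near: h; exact: generates_orbit.
Unshelve. all: by end_near. Qed.

Lemma orbit_left_continuous T s x : strong_semigroup T -> 0 < s ->
  left_continuous (T ^~ x) s.
Proof.
move=> [_ TD T0 /(_ s)[M M1 TM]] s0 e e0.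
near=> h.
have h0 : 0 < h by near: h; exact: nbhs_right_gt.
have hs : h < s by near: h; exact: nbhs_right_lt.
rewrite -{2}(subrK h s) (TD (s - h) h); [|lra..]; rewrite distrC -linearB.
have sh0 : 0 <= s - h by lra.
have shs : s - h <= s by lra.
apply: le_trans (TM _ _ sh0 shs) _.
rewrite -ler_pdivlMl; last lra.
by near: h; apply: T0; rewrite mulr_gt0// invr_gt0; lra.
Unshelve. all: by end_near. Qed.

(** F(a) is the integral of T(s) y over [0, a]. The difference T(h) F(a) - F(a) is the integral over
    [a, a + h] minus the one over [0, h], whence the generator takes the value T(a) y - y. *)
Lemma orbit_integral T y b : strong_semigroup T -> 0 < b ->
  exists F, [/\ F 0 = 0, right_derivative F 0 y &
    forall a, 0 < a < b -> generates T (F a) (T a y - y)].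
Proof.
move=> sgT b0; have [T0 TD Tc /(_ (2 * b))[M M1 TM]] := sgT.
(* Integrating up to 2 b makes F (a + h) available for a and h below b. *)
have [|||F [F0 FC Fd]] := @antiderivative _ _ (T ^~ y) (2 * b) (M * `|y|).
- lra.
- by move=> s /andP[s0 sb]; exact: TM.
- move=> e e0.
  have [d d0 Td] := near_right0 (Tc y (e / M) ltac:(rewrite divr_gt0//; lra)).
  exists (d / 2); first lra.
  move=> s t s0 st tb ts.
  have [->|ns] := eqVneq t s; first by rewrite subrr normr0 ltW.
  have lts : s < t by rewrite lt_neqAle eq_sym ns.
  rewrite -[t](subrK s) (addrC (t - s) s) TD; [|lra..].
  have sb : s <= 2 * b by lra.
  rewrite -linearB; apply: le_trans (TM _ _ s0 sb) _.
  by rewrite mulrC -ler_pdivlMr; [apply: Td; lra|lra].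
exists F; split=> //.
  by have := Fd 0; rewrite T0; apply; lra.
move=> a /andP[a0 ab] e e0.
have e2_gt0 : 0 < e / 2 by lra.
have zero2b : 0 <= (0 : R) < 2 * b by apply/andP; split; lra.
have a2b : 0 <= a < 2 * b by apply/andP; split; lra.
have Fd0 := Fd 0 zero2b _ e2_gt0; have Fda := Fd a a2b _ e2_gt0.
near=> h.
have h0 : 0 < h by near: h; exact: nbhs_right_gt.
have hb : h < b by near: h; exact: nbhs_right_lt.
(* As functions of a, both sides vanish at 0 and have the same right derivative, so the mean value
   inequality with slope 0 applies to their difference. *)
have FD : T h (F a) = F (a + h) - F h.
  have [Mh Mh1 TMh] : exists2 M, 1 <= M & forall x, `|T h x| <= M * `|x|.
    have [_ _ _ /(_ h)[N N1 TN]] := sgT.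
    by exists N => // x; apply: TN => //; exact: ltW.
  pose D s := T h (F s) - (F (s + h) - F h).
  have D0 : D 0 = 0 by rewrite /D F0 linear0 (add0r h) subrr subr0.
  suff : `|D a - D 0| <= 0 * (a - 0).
    by rewrite D0 subr0 mul0r normr_le0 => /eqP/subr0_eq.
  have CM : 0 <= M * `|y| by rewrite mulr_ge0//; lra.
  apply: mean_value_right; first exact: ltW.
    move=> s /andP[s0 sa].
    have D2 : lipschitz_on D 0 b (Mh * (M * `|y|) + M * `|y|).
      move=> u v u0 uv vb; rewrite /D.
      rewrite (_ : _ - _ - _ = (T h (F v) - T h (F u)) -
        (F (v + h) - F (u + h))); last by lmod R.
      rewrite -linearB; apply: (le_trans (ler_normB _ _)).
      have := FC u v u0 uv ltac:(lra).
      have := FC (u + h) (v + h) ltac:(lra) ltac:(lra) ltac:(lra).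
      have := TMh (F v - F u); set w := `|F v - F u|.
      rewrite (_ : v + h - (u + h) = v - u); last lra.
      move=> A B C; apply: (@le_trans _ _ (Mh * (M * `|y| * (v - u)) +
        M * `|y| * (v - u))).
        by apply: lerD => //; apply: le_trans A _; rewrite ler_wpM2l//; lra.
      by rewrite mulrDl mulrA.
    by apply: (lipschitz_left_continuous D2); lra.
  move=> s /andP[s0 sa] e1 e10.
  have e2 : 0 < e1 / 2 / Mh by rewrite !divr_gt0//; lra.
  have e3 : 0 < e1 / 2 by lra.
  have s2b : 0 <= s < 2 * b by apply/andP; split; lra.
  have sh2b : 0 <= s + h < 2 * b by apply/andP; split; lra.
  near=> k.
  have k0 : 0 < k by near: k; exact: nbhs_right_gt.
  rewrite /D (addrAC s k h).
  have TsE : T (s + h) y = T h (T s y) by rewrite addrC TD// ltW.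
  rewrite (_ : _ - _ - _ = (T h (F (s + k)) - T h (F s) - k *: T h (T s y)) -
     (F (s + h + k) - F (s + h) - k *: T (s + h) y)); last by rewrite TsE; lmod R.
  rewrite -linearZ -!linearB.
  apply: (le_trans (ler_normB _ _)).
  have A : `|F (s + k) - F s - k *: T s y| <= e1 / 2 / Mh * k.
    by near: k; exact: Fd.
  have B : `|F (s + h + k) - F (s + h) - k *: T (s + h) y| <= e1 / 2 * k.
    by near: k; exact: Fd.
  have := TMh (F (s + k) - F s - k *: T s y).
  have : Mh * `|F (s + k) - F s - k *: T s y| <= Mh * (e1 / 2 / Mh * k).
    by rewrite ler_wpM2l//; lra.
  have -> : Mh * (e1 / 2 / Mh * k) = e1 / 2 * k.
    by rewrite mulrA (mulrC Mh) divfK// gt_eqF//; lra.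
  by lra.
rewrite FD (_ : _ - _ - _ =
  (F (a + h) - F a - h *: T a y) - (F h - F 0 - h *: T 0 y)); last first.
  by rewrite F0 T0; lmod R.
apply: (le_trans (ler_normB _ _)).
have : `|F (a + h) - F a - h *: T a y| <= e / 2 * h by near: h; exact: Fda.
have : `|F (0 + h) - F 0 - h *: T 0 y| <= e / 2 * h by near: h; exact: Fd0.
by rewrite add0r; lra.
Unshelve. all: by end_near. Qed.

(** The averages F(a) / a lie in the domain and tend to y, the right derivative of F at 0. *)
Lemma generates_dense T y e : strong_semigroup T -> 0 < e ->
  exists x z, generates T x z /\ `|x - y| <= e.
Proof.
move=> sgT e0; have [F [F0 Fd Fg]] := orbit_integral y sgT ltr01.
have [d d0 Fdd] := near_right0 (Fd e e0).
pose a := Num.min (d / 2) (1 / 2).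
have a0 : 0 < a by rewrite lt_min; apply/andP; split; lra.
have ad : a <= d / 2 by rewrite ge_min lexx.
have a1 : a <= 1 / 2 by rewrite ge_min lexx orbT.
exists (a^-1 *: F a), (a^-1 *: (T a y - y)); split.
  have g0 : generates T 0 0.
    move=> e1 e10; near=> h; rewrite linear0 scaler0 !subr0 normr0.
    by rewrite mulr_ge0//; exact: ltW.
  rewrite -[_ *: F a]addr0 -[_ *: (_ - _)]addr0; apply: generates_lin => //.
  by apply: Fg; lra.
have := Fdd a a0 ltac:(lra); rewrite add0r F0 subr0 => Fa.
have -> : a^-1 *: F a - y = a^-1 *: (F a - a *: y).
  by rewrite scalerBr scalerA mulVf ?scale1r// gt_eqF.
by rewrite normrZ normfV gtr0_norm// ler_pdivrMl// mulrC.
Unshelve. all: by end_near. Qed.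

End Generators.

Section Resolvents.
Context {R : realType} {X : completeNormedModType R}.
Implicit Types (T S : R -> {linear X -> X}) (x y z : X) (mu : R).

Lemma expR_taylor1 (x : R) : `|x| <= 1 / 2 -> `|expR x - 1 - x| <= 2 * `|x| ^+ 2.
Proof.
move=> x2; have [xl xu] : - (1 / 2) <= x /\ x <= 1 / 2.
  by apply/andP; rewrite -ler_norml.
have e1 := expR_ge1Dx x; have e2 := expR_ge1Dx (- x).
rewrite ger0_norm; last by lra.
have : expR x * (1 - x) <= 1.
  by rewrite -[leRHS](expRxMexpNx_1 x) ler_wpM2l ?expR_ge0.
rewrite real_normK ?num_real//; set E := expR x in e1 *; nra.
Qed.

Lemma expR_sub1 (x : R) : `|x| <= 1 / 2 -> `|expR x - 1| <= 2 * `|x|.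
Proof.
move=> x2; have := expR_taylor1 x2; have := ler_normD (expR x - 1 - x) x.
by rewrite subrK; have := normr_ge0 x; nra.
Qed.

(** Its generator is that of T minus mu, so solving the resolvent equation at mu amounts to
    inverting this generator. *)
Definition rescale mu T : R -> {linear X -> X} :=
  fun t => expR (- (mu * t)) \*: T t.

Lemma rescaleE mu T t x : rescale mu T t x = expR (- (mu * t)) *: T t x.
Proof. by []. Qed.

Lemma rescale_semigroup mu T : strong_semigroup T ->
  strong_semigroup (rescale mu T).
Proof.
move=> [T0 TD Tc TM]; have m0 := normr_ge0 mu; split.
- by move=> x; rewrite rescaleE mulr0 oppr0 expR0 scale1r T0.
- move=> s t x s0 t0; rewrite !rescaleE TD// [T s (_ *: _)]linearZ scalerA -expRD.
  by rewrite mulrDr opprD.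
- move=> x e e0; have x0 := normr_ge0 x.
  have d1 : 0 < 1 / (2 * (`|mu| + 1)) by rewrite divr_gt0//; lra.
  have d2 : 0 < e / (4 * ((`|mu| + 1) * (`|x| + 1)))
    by rewrite divr_gt0// !mulr_gt0//; lra.
  have e4 : 0 < e / 4 by lra.
  near=> h.
  have h0 : 0 < h by near: h; exact: nbhs_right_gt.
  have h1 : h < 1 / (2 * (`|mu| + 1)) by near: h; exact: nbhs_right_lt.
  have h2 : h < e / (4 * ((`|mu| + 1) * (`|x| + 1)))
    by near: h; exact: nbhs_right_lt.
  rewrite ltr_pdivlMr in h1; last lra.
  rewrite ltr_pdivlMr in h2; last by rewrite !mulr_gt0//; lra.
  have Th : `|T h x - x| <= e / 4 by near: h; exact: Tc.
  have mh : `|- (mu * h)| = `|mu| * h by rewrite normrN normrM (gtr0_norm h0).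
  have mh2 : `|- (mu * h)| <= 1 / 2 by rewrite mh; nra.
  have := expR_sub1 mh2; rewrite mh; set E := expR _ => E1.
  rewrite rescaleE -/E (_ : _ - _ = (T h x - x) + ((E - 1) *: (T h x - x) +
    (E - 1) *: x)); last by lmod R.
  apply: (le_trans (ler_normD _ _)).
  have := ler_normD ((E - 1) *: (T h x - x)) ((E - 1) *: x); rewrite !normrZ.
  rewrite mh in mh2; have := normr_ge0 (E - 1); have := normr_ge0 (T h x - x).
  set a := `|E - 1| in E1 *; set b := `|T h x - x| in Th *;
    set c := `|_ + _| => b0 a0.
  have : a * b <= 1 * (e / 4) by apply: ler_pM => //; lra.
  have : a * `|x| <= 2 * (`|mu| * h) * `|x| by rewrite ler_wpM2r.
  have : 0 <= h * `|mu| by rewrite mulr_ge0// ltW.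
  have : 0 <= h * `|x| by rewrite mulr_ge0// ltW.
  by lra.
- move=> a; have [M M1 TaM] := TM a.
  exists (expR (`|mu| * `|a|) * M).
    have : 1 <= expR (`|mu| * `|a|) by rewrite -expR0 ler_expR mulr_ge0.
    by nra.
  move=> t x t0 ta; rewrite rescaleE normrZ (ger0_norm (expR_ge0 _)) -mulrA.
  apply: ler_pM; [exact: expR_ge0|by []| |exact: TaM].
  rewrite ler_expR; apply: le_trans (ler_norm _) _; rewrite normrN normrM.
  by rewrite ler_wpM2l// (ger0_norm t0); exact: le_trans ta (ler_norm _).
Unshelve. all: by end_near. Qed.

Lemma generates_ext T S x y : (forall t, T t x = S t x) ->
  generates T x y -> generates S x y.
Proof. by move=> TS Txy e e0; near=> h; rewrite -TS; near: h; exact: Txy.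
Unshelve. all: by end_near. Qed.

Lemma generates_rescale mu T x w : generates T x w ->
  generates (rescale mu T) x (w - mu *: x).
Proof.
move=> Txw e e0.
have m0 := normr_ge0 mu; have x0 := normr_ge0 x; have w0 := normr_ge0 w.
pose K := 2 * `|mu| * `|w| + 2 * `|mu| ^+ 2 * `|x| + 1.
have K0 : 0 < K by rewrite /K ltr_wpDl// addr_ge0// !mulr_ge0.
have d1 : 0 < 1 / (2 * (`|mu| + 1)) by rewrite divr_gt0//; lra.
have d2 : 0 < e / 2 / K by rewrite !divr_gt0.
have e4 : 0 < e / 4 by lra.
near=> h.
have h0 : 0 < h by near: h; exact: nbhs_right_gt.
have h1 : h < 1 / (2 * (`|mu| + 1)) by near: h; exact: nbhs_right_lt.
have h2 : h < e / 2 / K by near: h; exact: nbhs_right_lt.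
rewrite ltr_pdivlMr in h1; last lra.
rewrite ltr_pdivlMr// in h2.
have Th : `|T h x - x - h *: w| <= e / 4 * h by near: h; exact: Txw.
have mh : `|- (mu * h)| = `|mu| * h by rewrite normrN normrM (gtr0_norm h0).
have mh2 : `|- (mu * h)| <= 1 / 2 by rewrite mh; nra.
have := expR_taylor1 mh2; have := expR_sub1 mh2.
rewrite mh; rewrite mh in mh2; rewrite rescaleE; set E := expR _ => E1 E2.
rewrite (_ : _ - _ - _ = (T h x - x - h *: w) +
  ((E - 1) *: (T h x - x - h *: w) + ((E - 1) *: (h *: w) +
    (E - 1 - - (mu * h)) *: x)));
  last by lmod R.
have := ler_normD (T h x - x - h *: w) ((E - 1) *: (T h x - x - h *: w) +
  ((E - 1) *: (h *: w) + (E - 1 - - (mu * h)) *: x)).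
have := ler_normD ((E - 1) *: (T h x - x - h *: w)) ((E - 1) *: (h *: w) +
  (E - 1 - - (mu * h)) *: x).
have := ler_normD ((E - 1) *: (h *: w)) ((E - 1 - - (mu * h)) *: x).
rewrite !normrZ (gtr0_norm h0).
have : `|E - 1| * `|T h x - x - h *: w| <= 1 * (e / 4 * h)
  by apply: ler_pM => //; lra.
have : `|E - 1| * (h * `|w|) <= 2 * (`|mu| * h) * (h * `|w|).
  by rewrite ler_wpM2r// mulr_ge0// ltW.
have : `|E - 1 - - (mu * h)| * `|x|
  <= 2 * (`|mu| * h) ^+ 2 * `|x| by rewrite ler_wpM2r.
have : h * (h * K) <= h * (e / 2) by rewrite ler_wpM2l// ltW.
rewrite /K exprMn; have : 0 <= h * h by rewrite mulr_ge0// ltW.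
by lra.
Unshelve. all: by end_near. Qed.

(** No Laplace integral over a half-line is taken: the rescaled semigroup U satisfies |U(t)| <= 1/2
    at t = 2 M / mu, so z - U(t) z = y is solved by iteration, and the integral of U(s) z over
    [0, t] is the solution x. Conversely |U(t) x - x| <= M t |y| together with |U(t) x| <= |x| / 2
    gives mu |x| <= 4 M^2 |y|. *)
Lemma generates_resolvent T : strong_semigroup T ->
  exists2 C, 0 < C & exists2 mu0, 0 < mu0 & forall mu, mu0 <= mu ->
    (forall y, exists x, generates T x (mu *: x - y)) /\
    (forall x y, generates T x (mu *: x - y) -> mu * `|x| <= C * `|y|).
Proof.
move=> sgT; have [_ _ _ /(_ 1)[M M1 TM]] := sgT.
exists (4 * M ^+ 2); first by rewrite mulr_gt0// exprn_gt0//; lra.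
exists (2 * M); first lra.
move=> mu muM; have mu0 : 0 < mu by lra.
pose U := rescale mu T; have sgU : strong_semigroup U := rescale_semigroup mu sgT.
have UM s x : 0 <= s -> s <= 1 -> `|U s x| <= M * `|x|.
  move=> s0 s1; rewrite rescaleE normrZ (ger0_norm (expR_ge0 _)).
  apply: le_trans (TM _ x s0 s1); rewrite ler_piMl// -expR0 ler_expR oppr_le0.
  by rewrite mulr_ge0// ltW.
(* The condition mu >= 2 M keeps t <= 1, where M bounds T, and exp(-2 M) M <= 1/2 gives the
   contraction. *)
pose t := 2 * M / mu.
have t0 : 0 < t by rewrite divr_gt0//; lra.
have t1 : t <= 1 by rewrite ler_pdivrMr// mul1r.
have mut : mu * t = 2 * M by rewrite mulrC divfK// gt_eqF.
have Ut x : `|U t x| <= 1 / 2 * `|x|.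
  rewrite rescaleE normrZ (ger0_norm (expR_ge0 _)).
  rewrite mut.
  have := TM t x (ltW t0) t1; have := expR_ge1Dx (2 * M).
  have : expR (2 * M) * expR (- (2 * M)) = 1 := expRxMexpNx_1 _.
  have := expR_ge0 (- (2 * M)).
  set E := expR (2 * M); set E' := expR (- (2 * M)) => E'0 EE' E1 TxM.
  have E'M : E' * M <= 1 / 2 by nra.
  apply: (@le_trans _ _ (E' * (M * `|x|))); first by rewrite ler_wpM2l.
  by rewrite mulrA ler_wpM2r.
split=> [y|x y gxy].
  have [z zE] : exists z, z - U t z = y.
    pose u := fix u n : X := if n is n'.+1 then y + U t (u n') else 0.
    have uS n : u n.+1 = y + U t (u n) by [].
    have u0 : u 0%N = 0 by [].
    have [|l lP] := @geometric_limit _ _ u `|y|.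
      elim=> [|n IHn]; first by rewrite uS u0 linear0 addr0 subr0 expr0 mulr1.
      rewrite (_ : _ - _ = U t (u n.+1 - u n)); last first.
        by rewrite linearB (uS n.+1) [in LHS](uS n); lmod R.
      by have := Ut (u n.+1 - u n); rewrite exprS; lra.
    exists l; apply/eqP; rewrite -subr_eq0 -normr_le0.
    apply: (@ler_pow_half _ _ _ (4 * `|y|)) => n.
    rewrite add0r (_ : _ - _ = (l - u n.+1) + U t (u n - l)); last first.
      by rewrite linearB uS; lmod R.
    have := ler_normD (l - u n.+1) (U t (u n - l)); have := Ut (u n - l).
    have := lP n; have := lP n.+1; rewrite exprS (distrC (u n) l).
    have : 0 <= `|y| * 2^-1 ^+ n by rewrite mulr_ge0// exprn_ge0.
    by lra.
  have t01 : 0 < t + 1 by lra.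
  have [F [_ _ Fg]] := orbit_integral z sgU t01.
  exists (F t).
  have /(generates_rescale (- mu)) : generates U (F t) (- y).
    by rewrite -zE opprB; apply: Fg; rewrite t0; lra.
  rewrite scaleNr opprK addrC; apply: generates_ext => s.
  by rewrite !rescaleE scalerA -expRD mulNr opprK subrr expR0 scale1r.
have gU : generates U x (- y).
  by have := generates_rescale mu gxy; rewrite (_ : _ - _ - _ = - y)//; lmod R.
have : `|U t x - U 0 x| <= M * `|y| * (t - 0).
  apply: (@mean_value_right _ _ (U ^~ x)); first exact: ltW.
    by move=> s /andP[s0 _]; exact: orbit_left_continuous.
  move=> s /andP[s0 st] e e0.
  have der := orbit_right_derivative sgU s0 gU e0.
  near=> h.
  have h0 : 0 < h by near: h; exact: nbhs_right_gt.
  have : `|U (s + h) x - U s x - h *: U s (- y)| <= e * h by near: h.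
  have := UM s (- y) s0 ltac:(lra); rewrite normrN.
  have := ler_normD (U (s + h) x - U s x - h *: U s (- y)) (h *: U s (- y)).
  rewrite subrK normrZ (gtr0_norm h0).
  by nra.
have [U0 _ _ _] := sgU; rewrite U0 subr0.
have := ler_distD (U t x) 0 x; rewrite !sub0r !normrN; have := Ut x.
move=> A B C.
have : mu * `|x| <= mu * (2 * (M * `|y| * t)) by rewrite ler_wpM2l//; lra.
rewrite [leRHS](_ : _ = 2 * (M * `|y|) * (mu * t)); last by lra.
by rewrite mut; lra.
Unshelve. all: by end_near. Qed.

End Resolvents.

(** * Semigroups at small Yosida distance *)

Section Comparison.
Context {R : realType} {X : completeNormedModType R}.
Implicit Types (T S : R -> {linear X -> X}) (x y z u v w : X) (mu : R).

(** Here v = R(mu, A) x, and the claim is that mu R(mu, A) x tends to x. For x' in the domain the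
    error is R(mu, A) A x' = O(1/mu); density and the uniform bound on mu R(mu, A) do the rest. *)
Lemma yosida_identity T x e : strong_semigroup T -> 0 < e ->
  exists2 mu0, 0 < mu0 & forall mu v, mu0 <= mu ->
    generates T v (mu *: v - x) -> `|mu *: v - x| <= e.
Proof.
move=> sgT e0; have [C C0 [mu0 mu0_gt0 TC]] := generates_resolvent sgT.
have e1_gt0 : 0 < e / (2 * (C + 1)) by rewrite divr_gt0//; lra.
have [x' [w [gx'w x'x]]] := generates_dense x sgT e1_gt0.
have d0 : 0 < 2 * C * (`|w| + 1) / e.
  by rewrite divr_gt0// mulr_gt0//; have := normr_ge0 w; lra.
exists (Num.max mu0 (2 * C * (`|w| + 1) / e)).
  by rewrite lt_max mu0_gt0.
move=> mu v; rewrite ge_max => /andP[mu0mu emu] gv.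
have mu_gt0 : 0 < mu by lra.
(* The second vector is (mu - A) applied to the first, as A x' = w. *)
have [_ /(_ (v - mu^-1 *: x') (x - x' + mu^-1 *: w))] := TC mu mu0mu.
have -> : mu *: (v - mu^-1 *: x') - (x - x' + mu^-1 *: w) =
    - mu^-1 *: w + (mu *: v - x).
  rewrite scalerBr scalerA mulfV ?gt_eqF// scale1r; lmod R.
have -> : v - mu^-1 *: x' = - mu^-1 *: x' + v by lmod R.
move=> /(_ (generates_lin _ gx'w gv)).
have -> : mu * `|- mu^-1 *: x' + v| = `|mu *: v - x'|.
  rewrite -{1}(gtr0_norm mu_gt0) -normrZ scalerDr scalerA mulrN mulfV ?gt_eqF//.
  by congr `|_|; lmod R.
have := ler_normD (x - x') (mu^-1 *: w); rewrite normrZ gtr0_norm ?invr_gt0//.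
have := ler_distD x' (mu *: v) x; rewrite (distrC x x').
have w0 := normr_ge0 w.
have muw : mu^-1 * `|w| * (2 * C) <= e.
  rewrite -mulrA ler_pdivrMl//; rewrite ler_pdivrMr// in emu; lra.
rewrite ler_pdivlMr in x'x; last lra.
move=> H1 H2 H3.
have : C * `|x - x' + mu^-1 *: w| <= C * (`|x' - x| + mu^-1 * `|w|).
  by rewrite ler_wpM2l// ltW.
by lra.
Qed.

(* For generators [A] of [T] and [B] of [S], this says that the Yosida
   approximations of [A] and [B] eventually differ by at most [delta]: here
   [v = R(mu, A) (mu z - w)] while [z = R(mu, B) (mu z - w)]. *)
Definition yosida_close T S delta : Prop := exists mu0, forall mu z w v,
  mu0 <= mu -> generates S z w -> generates T v (mu *: v - (mu *: z - w)) ->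
  mu ^+ 2 * `|v - z| <= delta * `|mu *: z - w|.

(** Any choice of solutions is linear, because the a priori bound with right-hand side 0 makes them
    unique. *)
Lemma resolvent_operator T : strong_semigroup T ->
  exists2 C, 0 < C & exists2 mu0, 0 < mu0 & forall mu, mu0 <= mu ->
    exists r : X -> X, [/\ forall y, generates T (r y) (mu *: r y - y),
      forall y, mu * `|r y| <= C * `|y| &
      forall a y y', r (a *: y + y') = a *: r y + r y'].
Proof.
move=> sgT; have [C C0 [mu0 mu0_gt0 TC]] := generates_resolvent sgT.
exists C => //; exists mu0 => // mu mu0mu; have [Tex Tbd] := TC mu mu0mu.
have [r rP] := choice Tex.
exists r; split => //; first by move=> y; exact: Tbd.
move=> a y y'.
suff : mu * `|r (a *: y + y') - (a *: r y + r y')| <= C * `|0 : X|.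
  rewrite normr0 mulr0 pmulr_rle0; last lra.
  by rewrite normr_le0 subr_eq0 => /eqP.
apply: Tbd; rewrite subr0.
have := generates_lin (-1) (generates_lin a (rP y) (rP y')) (rP (a *: y + y')).
congr (generates T _ _); lmod R.
Qed.

Lemma resolvent_intertwine T S r mu K M tau c u w t :
  strong_semigroup T -> strong_semigroup S -> 0 < M -> 0 <= K ->
  (forall s x, 0 <= s -> s <= tau -> `|T s x| <= M * `|x|) ->
  (forall y, generates T (r y) (mu *: r y - y)) ->
  (forall y, `|r y| <= K * `|y|) ->
  (forall a y y', r (a *: y + y') = a *: r y + r y') ->
  generates S u w -> 0 <= t -> t <= tau ->
  (forall s, 0 <= s -> s <= t ->
     `|S s u - r (mu *: S s u - S s w)| <= c) ->
  `|r (S t u) - T t (r u)| <= M * c * t.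
Proof.
move=> sgT sgS M0 K0 TM rT rK rlin gu t0 ttau rc.
have [T0 TD Tc _] := sgT; have [S0 SD _ _] := sgS.
have r0 : r 0 = 0.
  apply/eqP; rewrite -normr_le0; apply: le_trans (rK 0) _.
  by rewrite normr0 mulr0.
have rZ a y : r (a *: y) = a *: r y by rewrite -[a *: y]addr0 rlin r0 addr0.
have rB y y' : r (y - y') = r y - r y'.
  by rewrite (addrC y) -(scaleN1r y') rlin scaleN1r (addrC (r y)).
pose g s := T (t - s) (r (S s u)).
suff: `|g t - g 0| <= M * c * (t - 0) by rewrite /g subrr T0 S0 !subr0.
apply: mean_value_right => // s.
  move=> /andP[s0 st] e e0.
  have ts0 : 0 <= t - s by rewrite subr_ge0.
  have tst : t - s <= tau by apply: le_trans ttau; rewrite gerBl ltW.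
  pose e1 := e / (M * (M * K + 1)).
  have MK : 0 < M * (M * K + 1).
    by rewrite mulr_gt0// ltr_wpDl// mulr_ge0// ltW.
  have e1_gt0 : 0 < e1 by rewrite divr_gt0.
  have eE : e = M * (M * (K * e1) + e1).
    by rewrite -[X in _ * (_ + X)]mul1r
      (mulrA M K) -mulrDl mulrA mulrC divfK// gt_eqF.
  have Sl := orbit_left_continuous u sgS s0 e1_gt0.
  have Tl := Tc (r (S s u)) _ e1_gt0.
  near=> h.
  have h0 : 0 < h by near: h; exact: nbhs_right_gt.
  have hs : h < s by near: h; exact: nbhs_right_lt.
  have htau : h <= tau.
    exact: le_trans (ltW hs) (le_trans st ttau).
  have Slh : `|S (s - h) u - S s u| <= e1 by near: h.
  have Tlh : `|T h (r (S s u)) - r (S s u)| <= e1 by near: h.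
  have -> : g (s - h) - g s = T (t - s) (T h (r (S (s - h) u - S s u)) +
      (T h (r (S s u)) - r (S s u))).
    rewrite /g (_ : t - (s - h) = t - s + h); last by rewrite opprB addrCA addrC.
    rewrite (TD _ _ _ ts0 (ltW h0)) rB -linearB; congr (T _ _).
    by rewrite linearB; lmod R.
  apply: le_trans (TM _ _ ts0 tst) _; rewrite eE ler_wpM2l ?(ltW M0)//.
  apply: le_trans (ler_normD _ _) _; apply: lerD => //.
  apply: le_trans (TM _ _ (ltW h0) htau) _; rewrite ler_wpM2l ?(ltW M0)//.
  by apply: le_trans (rK _) _; rewrite ler_wpM2l.
move=> /andP[s0 st] e e0.
have stau : s <= tau by exact: le_trans (ltW st) ttau.
pose e1 := e / (M * (K + 1)).
have MK : 0 < M * (K + 1) by rewrite mulr_gt0// ltr_wpDl.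
have e1_gt0 : 0 < e1 by rewrite divr_gt0.
have eE : e = M * (K * e1 + e1).
  by rewrite -[X in _ * (_ + X)]mul1r -mulrDl mulrA mulrC divfK// gt_eqF.
pose z := S s u; pose ws := S s w.
have Sd : \forall h \near (0 : R)^'+, `|S h z - z - h *: ws| <= e1 * h.
  by apply: generates_orbit e1_gt0.
have Td := rT z _ e1_gt0.
near=> h.
have h0 : 0 < h by near: h; exact: nbhs_right_gt.
have hs : h < t - s by near: h; apply: nbhs_right_lt; rewrite subr_gt0.
have Sdh : `|S h z - z - h *: ws| <= e1 * h by near: h.
have Tdh : `|T h (r z) - r z - h *: (mu *: r z - z)| <= e1 * h by near: h.
have tsh0 : 0 <= t - (s + h) by rewrite subr_ge0 -lerBrDl ltW.
have tsht : t - (s + h) <= tau.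
  by apply: le_trans ttau; rewrite gerBl addr_ge0// ltW.
(* Factoring out the operator at the later point leaves forward increments of S and T only. Their
   first-order parts combine into h (z - r (mu z - ws)), which is controlled by c. *)
have -> : g (s + h) - g s = T (t - (s + h)) (r (S h z - z - h *: ws) -
    (T h (r z) - r z - h *: (mu *: r z - z)) + h *: (z - r (mu *: z - ws))).
  rewrite /g (_ : t - s = t - (s + h) + h); last by rewrite opprD addrA subrK.
  rewrite (addrC s h) (SD _ _ _ (ltW h0) s0) -/z (addrC h s).
  rewrite (TD _ _ _ tsh0 (ltW h0)).
  by rewrite -linearB; congr (T _ _); rewrite !rB !rZ; lmod R.
apply: le_trans (TM _ _ tsh0 tsht) _.
rewrite eE -mulrDr -mulrA ler_wpM2l ?(ltW M0)// [leRHS]mulrDl [leRHS]addrC.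
apply: le_trans (ler_normD _ _) _; apply: lerD; last first.
  rewrite normrZ (gtr0_norm h0) mulrC ler_wpM2r ?(ltW h0)//.
  by apply: rc => //; exact: ltW.
apply: le_trans (ler_normB _ _) _; rewrite mulrDl; apply: lerD => //.
by rewrite -mulrA; apply: le_trans (rK _) _; rewrite ler_wpM2l.
Unshelve. all: by end_near. Qed.

Lemma yosida_close_orbit T S delta tau M b u w t :
  strong_semigroup T -> strong_semigroup S -> yosida_close T S delta ->
  0 <= delta -> 1 <= M -> 0 <= b ->
  (forall s x, 0 <= s -> s <= tau -> `|T s x| <= M * `|x|) ->
  (forall s, 0 <= s -> s <= tau -> `|S s u| <= b) ->
  generates S u w -> 0 <= t -> t <= tau ->
  `|S t u - T t u| <= delta * tau * M * b.
Proof.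
move=> sgT sgS [mu1 TS] delta0 M1 b0 TM Sb gu t0 ttau.
have [T0 TD Tc _] := sgT; have [S0 SD Sc /(_ tau)[N N1 SN]] := sgS.
have [C C0 [mu0 mu0_gt0 TC]] := resolvent_operator sgT.
apply/ler_addgt0Pr => e e_gt0.
have M0 : 0 < M by lra.
(* One share for the identity at S t u, M shares for the one at u, to which T t is applied, and one
   for the term with W / mu. *)
have e1_gt0 : 0 < e / (M + 2) by rewrite divr_gt0//; lra.
have [mu2 mu2_gt0 TSt] := yosida_identity (S t u) sgT e1_gt0.
have [mu3 mu3_gt0 Tu] := yosida_identity u sgT e1_gt0.
have w0 := normr_ge0 w.
pose W := N * `|w|.
have W0 : 0 <= W by rewrite mulr_ge0//; lra.
(* Exceeds all thresholds at once; the last summand makes the W / mu term fit into its share of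
   e. *)
pose mu := `|mu1| + mu0 + mu2 + mu3 + M * delta * W * tau / (e / (M + 2)).
have tau0 : 0 <= tau by lra.
have c0 : 0 <= M * delta * W * tau / (e / (M + 2)).
  by rewrite divr_ge0 ?(ltW e1_gt0)// !mulr_ge0//; lra.
have mu1mu : mu1 <= mu by have := ler_norm mu1; rewrite /mu; lra.
have mu0mu : mu0 <= mu by have := normr_ge0 mu1; rewrite /mu; lra.
have mu2mu : mu2 <= mu by have := normr_ge0 mu1; rewrite /mu; lra.
have mu3mu : mu3 <= mu by have := normr_ge0 mu1; rewrite /mu; lra.
have mu_gt0 : 0 < mu by lra.
have muc : M * delta * W * tau / mu <= e / (M + 2).
  rewrite ler_pdivrMr// (mulrC (e / (M + 2))) -ler_pdivrMr//.
  by have := normr_ge0 mu1; rewrite /mu; lra.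
have [r [rT rC rlin]] := TC mu mu0mu.
have Cmu0 : 0 <= C / mu by rewrite divr_ge0 ?(ltW C0)// ltW.
have rCmu y : `|r y| <= C / mu * `|y|.
  by have := rC y; rewrite -ler_pdivlMl// mulrA (mulrC mu^-1).
(* This is delta / mu^2 times mu b + W, a bound of mu S(s) u - S(s) w on [0, tau]. *)
pose c := delta * (b + W / mu) / mu.
have muc' : mu * c = delta * (b + W / mu) by rewrite mulrC /c divfK// gt_eqF.
have main : mu * `|r (S t u) - T t (r u)| <= M * delta * (b + W / mu) * tau.
  have c1 : 0 <= mu * c by rewrite muc' mulr_ge0// addr_ge0// divr_ge0// ltW.
  apply: (@le_trans _ _ (mu * (M * c * t))); last first.
    rewrite -[M * delta * _]mulrA -muc' [leLHS]mulrA mulrCA.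
    by apply: ler_pM => //; rewrite mulr_ge0// ltW.
  rewrite ler_wpM2l ?(ltW mu_gt0)//.
  apply: (resolvent_intertwine sgT sgS M0 Cmu0 TM rT rCmu rlin gu t0 ttau) =>
    s s0 st.
  have stau := le_trans st ttau; have gz := generates_orbit sgS s0 gu.
  have := TS mu _ _ _ mu1mu gz (rT _).
  rewrite distrC -ler_pdivlMl ?exprn_gt0// => /le_trans; apply.
  have : `|mu *: S s u - S s w| <= mu * (b + W / mu).
    apply: le_trans (ler_normB _ _) _; rewrite normrZ (gtr0_norm mu_gt0) mulrDr.
    rewrite (mulrC mu (W / mu)) divfK ?gt_eqF// lerD// ?ler_wpM2l ?(ltW mu_gt0)//.
      exact: Sb.
    exact: SN.
  move=> /(ler_wpM2l delta0) A; rewrite ler_pdivrMl ?exprn_gt0//.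
  have -> : mu ^+ 2 * c = mu * (mu * c) by rewrite expr2 mulrA.
  by rewrite muc' [leRHS]mulrCA.
have rTSt : `|mu *: r (S t u) - S t u| <= e / (M + 2) by apply: TSt.
have rTu : `|mu *: r u - u| <= e / (M + 2) by apply: Tu.
have TMu := TM t (mu *: r u - u) t0 ttau.
have -> : S t u - T t u = - (mu *: r (S t u) - S t u) +
   (mu *: (r (S t u) - T t (r u)) + T t (mu *: r u - u)).
  by rewrite [T t (_ - _)]linearB [T t (_ *: _)]linearZ_LR; lmod R.
have := ler_normD (- (mu *: r (S t u) - S t u)) (mu *: (r (S t u) - T t (r u)) +
  T t (mu *: r u - u)).
have := ler_normD (mu *: (r (S t u) - T t (r u))) (T t (mu *: r u - u)).
rewrite normrN [ `|mu *: (_ - _)|]normrZ (gtr0_norm mu_gt0).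
have : M * `|mu *: r u - u| <= M * (e / (M + 2)) by rewrite ler_wpM2l// ltW.
have eE : e / (M + 2) * (M + 2) = e by rewrite divfK// gt_eqF//; lra.
have : M * delta * (b + W / mu) * tau =
  delta * tau * M * b + M * delta * W * tau / mu.
  by lra.
set E := e / (M + 2) in eE e1_gt0 rTSt rTu muc *.
by lra.
Unshelve. all: by end_near. Qed.

Lemma yosida_close_semigroups T S delta tau M :
  strong_semigroup T -> strong_semigroup S -> yosida_close T S delta ->
  0 <= delta -> 0 <= tau -> 1 <= M ->
  (forall s x, 0 <= s -> s <= tau -> `|T s x| <= M * `|x|) ->
  delta * tau * M <= 1 / 2 ->
  forall t x, 0 <= t -> t <= tau ->
  `|S t x - T t x| <= 2 * delta * tau * M ^+ 2 * `|x|.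
Proof.
move=> sgT sgS TS delta0 tau0 M1 TM deltaM.
have [_ _ _ /(_ tau)[N N1 SN]] := sgS.
have M0 : 0 <= M by lra.
have bound u w : generates S u w -> forall t, 0 <= t -> t <= tau ->
    `|S t u| <= 2 * M * `|u|.
  move=> gu t t0 tt; apply: (@ler_pow_half _ _ _ (N * `|u|)) => n.
  elim: n t t0 tt => [|n IHn] t t0 tt.
    rewrite expr0 mulr1; apply: le_trans (SN _ _ t0 tt) _.
    by rewrite lerDr !mulr_ge0.
  have b0 : 0 <= 2 * M * `|u| + N * `|u| * 2^-1 ^+ n.
    by rewrite addr_ge0// !mulr_ge0// ?exprn_ge0//; lra.
  have := yosida_close_orbit sgT sgS TS delta0 M1 b0 TM IHn gu t0 tt.
  have := TM t u t0 tt; have := ler_distD (T t u) (S t u) 0; rewrite !subr0 exprS.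
  have := ler_wpM2r b0 deltaM.
  by lra.
move=> t x t0 tt; apply/ler_addgt0Pr => e e0.
pose c := 2 * delta * tau * M ^+ 2.
have c0 : 0 <= c by rewrite !mulr_ge0// exprn_ge0.
(* The total weight of |u - x| when x is replaced by a nearby u in the domain. *)
have K0 : 0 < N + M + c by lra.
have d0 : 0 < e / (N + M + c) by rewrite divr_gt0.
have [u [w [gu ux]]] := generates_dense x sgS d0.
have b0 : 0 <= 2 * M * `|u| by rewrite !mulr_ge0.
have := yosida_close_orbit sgT sgS TS delta0 M1 b0 TM (bound _ _ gu) gu t0 tt.
have -> : delta * tau * M * (2 * M * `|u|) = c * `|u| by rewrite /c expr2; lra.
have -> : S t x - T t x = (S t u - T t u) - (S t (u - x) - T t (u - x)).
  by rewrite (linearB (S t)) (linearB (T t)); lmod R.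
have := ler_normB (S t u - T t u) (S t (u - x) - T t (u - x)).
have := ler_normB (S t (u - x)) (T t (u - x)).
have := SN t (u - x) t0 tt; have := TM t (u - x) t0 tt.
have : c * `|u| <= c * (`|x| + `|u - x|).
  by rewrite ler_wpM2l//; have := ler_normD x (u - x); rewrite subrKC.
rewrite ler_pdivlMr// in ux; rewrite -/c; lra.
Qed.

End Comparison.

(** * Bounded solutions of difference equations and dichotomies *)

Section BoundedSolutions.
Context {R : realType} {X : completeNormedModType R}.
Implicit Types f : int -> X.

Definition solves (L : {linear X -> X}) f (x : int -> X) :=
  forall n, x (n + 1) = L (x n) + f n.

Definition bounded_by (B : R) (x : int -> X) := forall n, `|x n| <= B.

Section Perturbation.
Variables (L L' P : {linear X -> X}) (b : X -> X) (p kappa eps : R).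
Hypothesis p0 : 0 <= p.
Hypothesis Pp : forall x, `|P x| <= p * `|x|.
Hypothesis PP : forall x, P (P x) = P x.
Hypothesis LP : forall x, L (P x) = P (L x).
Hypothesis Lstable : forall x, `|L (P x)| <= kappa * `|P x|.
Hypothesis bker : forall x, P x = 0 -> P (b x) = 0.
Hypothesis Lb : forall x, P x = 0 -> L (b x) = x.
Hypothesis bL : forall x, P x = 0 -> b (L x) = x.
Hypothesis bstable : forall x, P x = 0 -> `|b x| <= kappa * `|x|.
Hypothesis L'L : forall x, `|L' x - L x| <= eps * `|x|.
Hypothesis kappa0 : 0 <= kappa.
Hypothesis eps0 : 0 <= eps.
Hypothesis kappa_small : kappa * (1 + p) <= 1 / 16.
Hypothesis eps_small : eps * (1 + p) <= 1 / 16.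

Let C x := x - P x.

Let PC x : P (C x) = 0.
Proof. by rewrite /C linearB PP subrr. Qed.

Let CB x y : C (x - y) = C x - C y.
Proof. by rewrite /C linearB; lmod R. Qed.

(** The function b is constrained only on the kernel of P; there it inherits additivity from L,
    whose inverse it is. *)
Let bB x y : P x = 0 -> P y = 0 -> b (x - y) = b x - b y.
Proof.
move=> Px Py; rewrite -[RHS]bL ?linearB; last by rewrite !bker// subrr.
by rewrite !Lb.
Qed.

(* Stable components are propagated forwards and unstable ones backwards, which
   makes the equation [solves L' f x] a contractive fixed point problem. *)
Let Phi f (x : int -> X) n := P (L' (x (n - 1)) + f (n - 1)) +
  b (C (x (n + 1) - (L' (x n) - L (x n)) - f n)).

Let PhiB f g (x y : int -> X) n :
  Phi f x n - Phi g y n = Phi (fun n => f n - g n) (fun n => x n - y n) n.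
Proof.
rewrite /Phi /=; set c1 := C _; set c2 := C _; set c3 := C _.
have -> : c3 = c1 - c2.
  by rewrite /c1 /c2 /c3 -CB (linearB L') (linearB L); congr C; lmod R.
rewrite bB ?PC// opprD addrACA -linearB; congr (P _ + _).
by rewrite (linearB L'); lmod R.
Qed.

(** The coefficients of B are three terms of at most 1/16 and one of at most 1/256. The rate 1/2 is
    the one that [geometric_limit] expects. *)
Let Phi_bound f x c B n : bounded_by c f -> bounded_by B x ->
  `|Phi f x n| <= B / 2 + (p + 1) * c.
Proof.
move=> fc xB.
have B0 : 0 <= B := le_trans (normr_ge0 _) (xB 0).
have c0 : 0 <= c := le_trans (normr_ge0 _) (fc 0).
have Cbound y : `|C y| <= (1 + p) * `|y|.
  by apply: le_trans (ler_normB _ _) _; rewrite mulrDl mul1r lerD2l.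
have L'L_B m : `|L' (x m) - L (x m)| <= eps * B.
  by apply: le_trans (L'L _) _; rewrite ler_wpM2l.
have H1 : `|P (L' (x (n - 1)) + f (n - 1))| <=
  kappa * (p * B) + p * (eps * B) + p * c.
  rewrite (_ : L' _ + _ = L (x (n - 1)) +
    (L' (x (n - 1)) - L (x (n - 1)) + f (n - 1))); last by lmod R.
  rewrite linearD -LP -[leRHS]addrA -mulrDr; apply: le_trans (ler_normD _ _) _.
  apply: lerD.
    apply: le_trans (Lstable _) _; rewrite ler_wpM2l//.
    by apply: le_trans (Pp _) _; rewrite ler_wpM2l.
  apply: le_trans (Pp _) _; rewrite ler_wpM2l//.
  by apply: le_trans (ler_normD _ _) _; rewrite lerD.
have H2 : `|b (C (x (n + 1) - (L' (x n) - L (x n)) - f n))| <=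
  kappa * ((1 + p) * (B + eps * B + c)).
  apply: le_trans (bstable (PC _)) _; rewrite ler_wpM2l//.
  apply: le_trans (Cbound _) _; rewrite ler_wpM2l ?addr_ge0//.
  apply: le_trans (ler_normB _ _) _; apply: lerD => //.
  by apply: le_trans (ler_normB _ _) _; apply: lerD.
apply: le_trans (ler_normD _ _) _; apply: le_trans (lerD H1 H2) _.
have kp : 0 <= kappa * p by rewrite mulr_ge0.
have ep : 0 <= eps * p by rewrite mulr_ge0.
have kB : kappa * (1 + p) * B <= 1 / 16 * B by rewrite ler_wpM2r.
have kc : kappa * (1 + p) * c <= 1 / 16 * c by rewrite ler_wpM2r.
have eB : eps * (1 + p) * B <= 1 / 16 * B by rewrite ler_wpM2r.
have keB : kappa * (1 + p) * (eps * B) <= 1 / 16 * (eps * B)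
  by rewrite ler_wpM2r// mulr_ge0.
have keB0 : 0 <= kappa * B by rewrite mulr_ge0.
have epB0 : 0 <= eps * p * B by rewrite mulr_ge0.
have eB0 : 0 <= eps * B by rewrite mulr_ge0.
by lra.
Qed.

(** A solution is a fixed point of Phi, so its bound can be improved repeatedly; the part coming
    from B is halved each time and disappears. *)
Lemma bounded_solution_bound f x c B : bounded_by c f -> bounded_by B x ->
  solves L' f x -> bounded_by (2 * (p + 1) * c) x.
Proof.
move=> fc xB xf n.
have PhiE m : Phi f x m = x m.
  rewrite /Phi -xf subrK xf (_ : _ - _ - _ = L (x m)); last by lmod R.
  have -> : C (L (x m)) = L (C (x m)) by rewrite /C linearB LP.
  by rewrite bL ?PC// /C; lmod R.
apply: (@ler_pow_half _ _ _ B) => j; elim: j n => [|j IHj] n.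
  rewrite expr0 mulr1; apply: le_trans (xB n) _; rewrite lerDr !mulr_ge0//.
    by rewrite addr_ge0.
  exact: le_trans (normr_ge0 _) (fc 0).
rewrite -PhiE exprS; apply: le_trans (Phi_bound _ fc IHj) _.
by lra.
Qed.

Lemma bounded_solution_exists f c : bounded_by c f ->
  exists2 x, solves L' f x & exists B, bounded_by B x.
Proof.
move=> fc.
pose u := fix u j : int -> X := if j is j'.+1 then Phi f (u j') else fun=> 0.
pose c1 := (p + 1) * c.
have c0 : 0 <= c := le_trans (normr_ge0 _) (fc 0).
have zero0 : bounded_by 0 (fun n => f n - f n) by move=> n; rewrite subrr normr0.
have uS j : bounded_by (c1 * 2^-1 ^+ j) (fun n => u j.+1 n - u j n).
  elim: j => [|j IHj] n.
    rewrite expr0 mulr1 /u subr0; have := @Phi_bound f (fun=> 0) c 0 n fc.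
    by rewrite mul0r add0r; apply => m; rewrite normr0.
  rewrite [u j.+2]/= [in X in _ - X]/= PhiB;
    apply: le_trans (Phi_bound n zero0 IHj) _.
  by rewrite mulr0 addr0 exprS; lra.
have /choice[x xP] : forall n, exists l, forall j,
  `|l - u j n| <= 2 * c1 * 2^-1 ^+ j.
  by move=> n; apply: geometric_limit => j; exact: uS.
have PhiE n : x n = Phi f x n.
  apply/eqP; rewrite -subr_eq0 -normr_le0;
    apply: (@ler_pow_half _ _ _ (2 * c1)) => j.
  have xu : bounded_by (2 * c1 * 2^-1 ^+ j) (fun n => u j n - x n).
    by move=> m; rewrite distrC.
  have := Phi_bound n zero0 xu; rewrite -PhiB.
  have := xP n j.+1; rewrite [u j.+1]/= exprS.
  have := ler_distD (Phi f (u j) n) (x n) (Phi f x n).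
  by lra.
exists x; last first.
  by exists (2 * c1 * 2^-1 ^+ 0) => n; have := xP n 0%N; rewrite subr0.
(* The residual d has stable part 0 by the fixed point equation at n + 1, and unstable part 0 by the
   one at n. *)
move=> n; apply/eqP; rewrite -subr_eq0; apply/eqP; set d := _ - _.
have Pd : P d = 0.
  rewrite /d [P _]linearB {1}PhiE /Phi addrK [P (_ + b _)]linearD PP bker ?PC//.
  by rewrite addr0 subrr.
have Cd : C d = 0.
  set D := x (n + 1) - (L' (x n) - L (x n)) - f n.
  have Cx : C (x n) = b (C D).
    have PE : P (x n) = P (L' (x (n - 1)) + f (n - 1)).
      by rewrite {1}PhiE /Phi [LHS]linearD PP bker ?PC// addr0.
    by rewrite {1}/C PE {1}PhiE /Phi -/D; lmod R.
  have LCx : L (C (x n)) = C D by rewrite Cx Lb.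
  rewrite (_ : d = D - L (x n)); last by rewrite /d /D; lmod R.
  by rewrite CB -LCx /C linearB LP subrr.
by rewrite -[d](subrK (P d)) -/(C d) Cd Pd addr0.
Qed.

End Perturbation.
End BoundedSolutions.

(** * Green functions of solvable difference equations *)

Section SolvableDichotomy.
Context {R : realType} {X : completeNormedModType R}.

(** Placed at -1 so that w enters between times -1 and 0: G w 0 has a bounded forward orbit, while G
    w 0 - w ends a bounded backward orbit. *)
Definition impulse (w : X) (n : int) : X := if n == -1 then w else 0.

Section GreenFunction.
Variables (L : {linear X -> X}) (K : R).
Hypothesis K1 : 1 <= K.
Hypothesis solvable : forall f c, bounded_by c f ->
  exists2 x, solves L f x & exists B, bounded_by B x.
Hypothesis bound : forall f x c B, bounded_by c f -> bounded_by B x ->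
  solves L f x -> bounded_by (K * c) x.

Lemma bounded_solution_unique f (x y : int -> X) B B' :
  bounded_by B x -> bounded_by B' y -> solves L f x -> solves L f y -> x =1 y.
Proof.
move=> xB yB xf yf n.
have zero0 : bounded_by 0 (fun=> 0 : X) by move=> m; rewrite normr0.
have xyB : bounded_by (B + B') (fun n => x n - y n).
  by move=> m; apply: le_trans (ler_normB _ _) _; apply: lerD.
have xy0 : solves L (fun=> 0) (fun n => x n - y n).
  by move=> m; rewrite xf yf linearB; lmod R.
have := bound zero0 xyB xy0 n; rewrite mulr0 normr_le0 subr_eq0.
by move/eqP.
Qed.

Lemma green_exists : exists G : X -> int -> X, forall w,
  solves L (impulse w) (G w) /\ bounded_by (K * `|w|) (G w).
Proof.
suff /choice[G GP] : forall w, exists g,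
    solves L (impulse w) g /\ bounded_by (K * `|w|) g by exists G.
move=> w; have wB : bounded_by `|w| (impulse w).
  by move=> n; rewrite /impulse; case: ifP => // _; rewrite normr0.
have [x xw [B xB]] := solvable wB; exists x; split => //.
exact: bound wB xB xw.
Qed.

Let K0 : 0 <= K. Proof. exact: le_trans ler01 K1. Qed.

Variable G : X -> int -> X.
Hypothesis Gw : forall w, solves L (impulse w) (G w).
Hypothesis Gbound : forall w, bounded_by (K * `|w|) (G w).

Lemma green_unique w x B : bounded_by B x -> solves L (impulse w) x -> G w =1 x.
Proof.
by move=> xB xw; apply: bounded_solution_unique (Gbound w) xB (Gw w) xw.
Qed.

Lemma green_linear n a w w' : G (a *: w + w') n = a *: G w n + G w' n.
Proof.
apply: (@green_unique _ (fun n => a *: G w n + G w' n) (`|a| * (K * `|w|) +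
  K * `|w'|)).
  move=> m; apply: le_trans (ler_normD _ _) _; rewrite normrZ lerD//.
    by rewrite ler_wpM2l//; exact: Gbound.
  exact: Gbound.
move=> m; rewrite !Gw [L (_ + _)]linearP /impulse; case: ifP => _; lmod R.
Qed.

(** By uniqueness, since J maps the solution for w to the one for J w. Used with J a time map of S
    and, in the end, with J a multiplication by a scalar. *)
Lemma green_commutes (J : {linear X -> X}) j w n :
  (forall x, `|J x| <= j * `|x|) -> 0 <= j -> (forall x, J (L x) = L (J x)) ->
  G (J w) n = J (G w n).
Proof.
move=> Jj j0 JL.
apply: (@green_unique _ (fun n => J (G w n)) (j * (K * `|w|))).
  by move=> m; apply: le_trans (Jj _) _; rewrite ler_wpM2l//; exact: Gbound.
move=> m; rewrite Gw linearD JL /impulse; case: ifP => // _.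
by rewrite linear0.
Qed.

Lemma green_step w n : n != -1 -> G w (n + 1) = L (G w n).
Proof. by move=> n1; rewrite Gw /impulse (negPf n1) addr0. Qed.

Lemma green_jump w : L (G w (-1)) = G w 0 - w.
Proof.
have := Gw w (-1); rewrite /impulse eqxx addNr => ->.
by rewrite addrK.
Qed.

Lemma green_forward w (k : nat) : G w k = iter k L (G w 0).
Proof.
elim: k => [//|k IHk]; rewrite iterS -IHk -green_step//.
by congr (G w _); rewrite -addn1 PoszD.
Qed.

Lemma green_backward w (k : nat) : iter k.+1 L (G w (- k.+1%:Z)) = G w 0 - w.
Proof.
elim: k => [|k IHk]; first exact: green_jump.
rewrite iterSr -green_step//.
by rewrite -IHk; congr (iter _ _ (G w _)); clear; lia.
Qed.

(** The response to the impulse G w 0 is G w cut off to 0 at negative times. *)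
Lemma green_idempotent w : G (G w 0) 0 = G w 0.
Proof.
apply: (@green_unique _ (fun n => if 0 <= n then G w n else 0) (K * `|w|)).
  by move=> n; case: ifP => _; [exact: Gbound|rewrite normr0 mulr_ge0].
move=> n; rewrite /impulse; have [n0|n0] := leP 0 n.
  have -> : 0 <= n + 1 by lia.
  have n1 : n != -1 by lia.
  by rewrite (negPf n1) green_step// addr0.
have [->|n1] := eqVneq n (-1); first by rewrite addNr lexx linear0 add0r.
have -> : (0 <= n + 1) = false by lia.
by rewrite linear0 addr0.
Qed.

(** The preimage is - G w (-1). Its response is G w delayed by one step and cut off to 0 from time 0
    on; the impulse at -1 cancels the last nonzero value. *)
Lemma green_kernel_preimage w : G w 0 = 0 ->
  exists2 v, G v 0 = 0 & L v = w.
Proof.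
move=> w0; exists (- G w (-1)); last by rewrite linearN green_jump w0 sub0r opprK.
apply: (@green_unique _ (fun n => if 0 <= n then 0 else G w (n - 1)) (K * `|w|)).
  by move=> n; case: ifP => _; [rewrite normr0 mulr_ge0|exact: Gbound].
move=> n; rewrite /impulse; have [n0|n0] := leP 0 n.
  have -> : 0 <= n + 1 by lia.
  have n1 : n != -1 by lia.
  by rewrite (negPf n1) linear0 addr0.
have [->|n1] := eqVneq n (-1).
  by rewrite addNr lexx -green_step// subrK subrr.
have -> : (0 <= n + 1) = false by lia.
rewrite addr0 -green_step; last by lia.
by rewrite subrK addrK.
Qed.

(* Multiplying the bounded solution by the weight [min |n| m], whose increments
   are at most 1, gives another bounded solution. *)
Lemma green_decay w (m : nat) (n : int) : `|n|%N = m ->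
  m%:R * `|G w n| <= K * (K + 1) * `|w|.
Proof.
move=> nm; pose c (n : int) : R := (minn `|n|%N m)%:R.
have cm : bounded_by (m%:R * (K * `|w|)) (fun n => c n *: G w n).
  move=> i; rewrite normrZ normr_nat; apply: ler_pM => //; last exact: Gbound.
  by rewrite ler_nat geq_minr.
pose f n := (c (n + 1) - c n) *: G w (n + 1) + c n *: impulse w n.
(* Increments of the weight contribute K |w|; the impulse contributes |w|, as the weight at -1 is at
   most 1. *)
have cf : bounded_by ((K + 1) * `|w|) f.
  move=> i; rewrite mulrDl mul1r; apply: le_trans (ler_normD _ _) _.
  rewrite !normrZ; apply: lerD.
    rewrite -[leRHS]mul1r; apply: ler_pM => //; last exact: Gbound.
    rewrite /c; have [ii|ii] := leqP (minn `|i|%N m) (minn `|(i + 1)%R|%N m).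
      by rewrite -natrB// normr_nat lern1; lia.
    by rewrite distrC -natrB ?(ltnW ii)// normr_nat lern1; lia.
  rewrite /impulse; case: eqP => [->|_]; last by rewrite normr0 mulr0.
  by rewrite normr_nat ler_piMl// lern1 geq_minl.
have cs : solves L f (fun n => c n *: G w n).
  by move=> i; rewrite /f linearZ_LR Gw; lmod R.
have := bound cf cm cs n; rewrite normrZ normr_nat /c nm minnn.
by rewrite mulrA.
Qed.

End GreenFunction.
End SolvableDichotomy.

(** * From one discrete time to the whole semigroup *)

Section SemigroupDichotomy.
Context {R : realType} {X : completeNormedModType R}.
Implicit Types (T S : R -> {linear X -> X}) (P Q : {linear X -> X}).

(* Condition (2) of an exponential dichotomy is split in two: surjectivity, and
   the lower bound in the last clause, which controls the inverse. *)
Definition dichotomy T P N beta : Prop :=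
  [/\ forall x, P (P x) = P x,
      forall t x, 0 <= t -> T t (P x) = P (T t x),
      forall t x, 0 <= t -> P x = 0 -> exists2 y, P y = 0 & T t y = x,
      forall t x, 0 <= t -> `|T t (P x)| <= N * expR (- beta * t) * `|P x|
    & forall t x, 0 <= t -> P x = 0 -> `|x| <= N * expR (- beta * t) * `|T t x|].

(** The exponent beta = ln 2 / a turns each factor 1/2 into exp(- beta a). The 2 in N = 2 M
    compensates for exp(- beta t) falling to 1/2 within one period. *)
Lemma halving_dichotomy S Q a : strong_semigroup S -> 0 < a ->
  (forall t x, 0 <= t -> S t (Q x) = Q (S t x)) ->
  (forall x, `|S a (Q x)| <= 1 / 2 * `|Q x|) ->
  (forall x, Q x = 0 -> `|x| <= 1 / 2 * `|S a x|) ->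
  exists N beta, [/\ 1 <= N, 0 < beta,
    forall t x, 0 <= t -> `|S t (Q x)| <= N * expR (- beta * t) * `|Q x| &
    forall t x, 0 <= t -> Q x = 0 -> `|x| <= N * expR (- beta * t) * `|S t x|].
Proof.
move=> [S0 SD Sc /(_ a)[M M1 SM]] a0 SQ Shalf Sdouble.
have ln2 : 0 < ln 2 :> R by rewrite ln_gt0// ltr1n.
pose beta := ln 2 / a; have beta0 : 0 < beta by rewrite divr_gt0.
have ba : expR (- beta * a) = 1 / 2.
  by rewrite mulNr /beta divfK ?gt_eqF// expRN lnK ?posrE// div1r.
have half t : t <= a -> 1 / 2 <= expR (- beta * t).
  by move=> ta; rewrite -ba ler_expR !mulNr lerN2 ler_wpM2l// ltW.
have shift t : 1 / 2 * expR (- beta * (t - a)) = expR (- beta * t).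
  by rewrite -ba -expRD -mulrDr subrKC.
have steps t : 0 <= t -> exists n, t <= n.+1%:R * a.
  move=> t0; exists (Num.truncn (t / a)); rewrite -ler_pdivrMr//.
  exact/ltW/truncnS_gt.
have M20 : 0 <= 2 * M by lra.
exists (2 * M), beta; split => //; first lra.
- move=> t x t0; have [n] := steps t t0; elim: n t x t0 => [|n IHn] t x t0 tn.
    rewrite mul1r in tn; apply: le_trans (SM _ _ t0 tn) _.
    rewrite ler_wpM2r//; have := ler_wpM2l M20 (half t tn); lra.
  have [ta|ta] := leP t a.
    apply: IHn => //; apply: le_trans ta _.
    by rewrite ler_peMl ?(ltW a0)// ler1n.
  have ta0 : 0 <= t - a by rewrite subr_ge0 ltW.
  rewrite -[t in S t](subrK a) (SD _ _ _ ta0 (ltW a0)) (SQ _ _ (ltW a0)).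
  apply: le_trans (IHn _ _ ta0 _) _.
    by rewrite lerBlDr; move: tn; rewrite -addn1 natrD mulrDl mul1r.
  rewrite -SQ ?(ltW a0)//.
  apply: le_trans (ler_wpM2l _ (Shalf x)) _.
    by rewrite mulr_ge0// expR_ge0.
  by rewrite -(shift t); lra.
- move=> t x t0; have [n] := steps t t0; elim: n t x t0 => [|n IHn] t x t0 tn Qx.
    rewrite mul1r in tn; apply: le_trans (Sdouble x Qx) _.
    have at0 : 0 <= a - t by rewrite subr_ge0.
    have ata : a - t <= a by rewrite gerBl.
    (* For t <= a the lower bound at time t comes from the one at a, since S a x = S (a - t) (S t x)
       has norm at most M |S t x|. *)
    rewrite -[a in S a](subrK t) (SD _ _ _ at0 t0).
    have := SM _ (S t x) at0 ata; have := half t tn; have := normr_ge0 (S t x).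
    set E := expR _; set u := `|S t x| => u0 Eh SMu.
    have : M * u * (1 / 2) <= M * u * E by rewrite ler_wpM2l// mulr_ge0//; lra.
    by have : 0 <= M * u by [rewrite mulr_ge0//; lra]; lra.
  have [ta|ta] := leP t a.
    apply: IHn => //; apply: le_trans ta _.
    by rewrite ler_peMl ?(ltW a0)// ler1n.
  have ta0 : 0 <= t - a by rewrite subr_ge0 ltW.
  apply: le_trans (Sdouble x Qx) _.
  have QSa : Q (S a x) = 0 by rewrite -SQ ?(ltW a0)// Qx linear0.
  have tan : t - a <= n.+1%:R * a.
    by rewrite lerBlDr; move: tn; rewrite -addn1 natrD mulrDl mul1r.
  have := IHn _ _ ta0 tan QSa.
  rewrite -(SD _ _ _ ta0 (ltW a0)) subrK -(shift t).
  by lra.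
Qed.

Lemma solvable_dichotomy S tau K : strong_semigroup S -> 0 < tau -> 1 <= K ->
  (forall f c, bounded_by c f ->
     exists2 x, solves (S tau) f x & exists B, bounded_by B x) ->
  (forall f x c B, bounded_by c f -> bounded_by B x ->
     solves (S tau) f x -> bounded_by (K * c) x) ->
  exists Q N beta, [/\ 1 <= N, 0 < beta, dichotomy S Q N beta,
    forall x, `|Q x| <= K * `|x| &
    forall (J : {linear X -> X}) j, 0 <= j -> (forall x, `|J x| <= j * `|x|) ->
      (forall t x, 0 <= t -> J (S t x) = S t (J x)) ->
      forall x, Q (J x) = J (Q x)].
Proof.
move=> sgS tau0 K1 solv bound.
have [S0 SD _ Sb] := sgS.
have [G GP] := green_exists solv bound.
have Gw w : solves (S tau) (impulse w) (G w) by case: (GP w).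
have GB w : bounded_by (K * `|w|) (G w) by case: (GP w).
have Qlin : linear (fun w => G w 0).
  by move=> a w w'; rewrite (green_linear bound Gw GB).
pose Q : {linear X -> X} :=
  HB.pack (fun w => G w 0) (GRing.isLinear.Build _ _ _ _ _ Qlin).
have QE w : Q w = G w 0 by [].
have QJ (J : {linear X -> X}) j x : 0 <= j -> (forall x, `|J x| <= j * `|x|) ->
    (forall t x, 0 <= t -> J (S t x) = S t (J x)) -> Q (J x) = J (Q x).
  move=> j0 Jj JS; rewrite !QE; apply: (green_commutes bound Gw GB) Jj j0 _ => y.
  by rewrite JS// ltW.
have SS s t x : 0 <= s -> 0 <= t -> S s (S t x) = S t (S s x).
  by move=> s0 t0; rewrite -!SD// addrC.
have SQ t x : 0 <= t -> S t (Q x) = Q (S t x).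
  move=> t0; have [M M1 SM] := Sb t.
  rewrite (@QJ (S t) M)//; first lra.
    by move=> y; exact: SM.
  by move=> s y s0; exact: SS.
have iterSn n x : iter n (S tau) x = S (n%:R * tau) x.
  elim: n => [|n IHn]; first by rewrite mul0r S0.
  rewrite iterS IHn -SD ?(ltW tau0)//; last by rewrite mulr_ge0// ltW.
  by congr (S _ x); rewrite -addn1 natrD; lra.
(* The first integer for which the O(1/|n|) bound guarantees a factor 1/2. *)
pose m := (Num.truncn (2 * (K * (K + 1)))).+1.
have m2 : 2 * (K * (K + 1)) <= m%:R by exact/ltW/truncnS_gt.
have m0 : 0 < m%:R :> R by rewrite ltr0n.
have a0 : 0 < m%:R * tau by rewrite mulr_gt0.
have decay x n : `|n|%N = m -> `|G x n| <= 1 / 2 * `|x|.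
  move=> nm; rewrite -(ler_pM2l m0);
    apply: le_trans (green_decay K1 bound Gw GB x nm) _.
  by have := normr_ge0 x; nra.
have QQ x : Q (Q x) = Q x by exact: (green_idempotent K1 bound Gw GB).
have [||N [beta [N1 beta0 stable unstable]]] := halving_dichotomy sgS a0 SQ.
- move=> x; rewrite -{1}QQ -iterSn QE -(green_forward Gw).
  exact: decay.
- move=> x Qx; have [M M1 SM] := Sb (m%:R * tau).
  (* Moving S (m tau) outside G gives the backward orbit run up to time 0, that is Q x - x = - x. *)
  have -> : `|x| = `|G (S (m%:R * tau) x) (- m%:Z)|.
    rewrite (@green_commutes _ _ _ _ bound _ Gw GB (S (m%:R * tau)) M).
    - by rewrite -iterSn (green_backward Gw) -QE Qx sub0r normrN.
    - by move=> y; apply: SM => //; exact: ltW.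
    - lra.
    - by move=> y; apply: SS; exact: ltW.
  by apply: decay; rewrite abszN.
exists Q, N, beta; split => //; last 2 first.
- by move=> x; exact: GB.
- by move=> J j j0 Jj JS x; exact: QJ Jj JS.
split => // t x t0 Qx.
have kerpre n : forall w, Q w = 0 -> exists2 v, Q v = 0 & S (n%:R * tau) v = w.
  elim: n => [|n IHn] w w0; first by exists w => //; rewrite mul0r S0.
  have [v v0 vw] := green_kernel_preimage K1 bound Gw GB w0.
  have [v' v'0 v'v] := IHn v v0; exists v' => //.
  by rewrite -iterSn /= iterSn v'v.
(* Preimages are known at multiples of tau only; one at n tau >= t, moved forward by n tau - t, is a
   preimage at t. *)
pose n := (Num.truncn (t / tau)).+1.
have nt : t <= n%:R * tau by rewrite -ler_pdivrMr//; exact/ltW/truncnS_gt.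
have [v v0 vx] := kerpre n x Qx.
have nt0 : 0 <= n%:R * tau - t by rewrite subr_ge0.
exists (S (n%:R * tau - t) v); first by rewrite -SQ// v0 linear0.
by rewrite -SD// subrKC.
Qed.
End SemigroupDichotomy.

Section Robustness.
Context {R : realType} {X : completeNormedModType R}.
Implicit Types (T S : R -> {linear X -> X}) (P Q : {linear X -> X}).

Theorem dichotomy_robust T P N beta p : strong_semigroup T ->
  1 <= N -> 0 < beta -> 0 <= p -> (forall x, `|P x| <= p * `|x|) ->
  dichotomy T P N beta ->
  exists2 delta, 0 < delta & forall S, strong_semigroup S ->
    yosida_close T S delta ->
    exists Q N' beta', [/\ 1 <= N', 0 < beta', dichotomy S Q N' beta',
      forall x, `|Q x| <= 2 * (p + 1) * `|x| &
      forall (J : {linear X -> X}) j, 0 <= j -> (forall x, `|J x| <= j * `|x|) ->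
        (forall t x, 0 <= t -> J (S t x) = S t (J x)) ->
        forall x, Q (J x) = J (Q x)].
Proof.
move=> sgT N1 beta0 p0 Pp [PP TP Psurj stable unstable].
(* Serves both as contraction rate of T(tau) and as allowed distance between S(tau) and T(tau). *)
pose k0 : R := 1 / 16 / (1 + p).
have k0_gt0 : 0 < k0 by rewrite !divr_gt0//; lra.
have k0p : k0 * (1 + p) = 1 / 16 by rewrite divfK// gt_eqF//; lra.
have k01 : k0 <= 1 by rewrite ler_pdivrMr; lra.
(* Then exp(beta tau) >= 1 + N / k0, whence N exp(- beta tau) <= k0 without logarithms. *)
pose tau := N / (beta * k0).
have tau0 : 0 < tau by rewrite divr_gt0 ?(mulr_gt0 beta0 k0_gt0)//; lra.
have Nk0 : N * expR (- beta * tau) <= k0.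
  rewrite mulNr expRN ler_pdivrMr ?expR_gt0//.
  have -> : beta * tau = N / k0 by rewrite /tau invfM mulrCA mulVKf// gt_eqF.
  apply: (@le_trans _ _ (k0 * (N / k0))); first by rewrite mulrC divfK// gt_eqF.
  rewrite ler_wpM2l ?(ltW k0_gt0)//; apply: le_trans (expR_ge1Dx _).
  by rewrite lerDr.
have [_ _ _ /(_ tau)[M M1 TM]] := sgT.
pose delta := k0 / (2 * tau * M ^+ 2).
have M_gt0 : 0 < M by lra.
have M2 : 0 < 2 * tau * M ^+ 2 := mulr_gt0 (mulr_gt0 (ltr0Sn R 1) tau0)
  (exprn_gt0 2 M_gt0).
have delta0 : 0 < delta by rewrite divr_gt0.
have deltaE : 2 * delta * tau * M ^+ 2 = k0.
  rewrite (_ : 2 * delta * tau * M ^+ 2 = delta * (2 * tau * M ^+ 2));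
    last by ring.
  by rewrite divfK// gt_eqF.
have deltaM : delta * tau * M <= 1 / 2.
  have dt : 0 <= delta * tau * M := mulr_ge0 (mulr_ge0 (ltW delta0) (ltW tau0))
    (ltW M_gt0).
  have : delta * tau * M * 1 <= delta * tau * M * M by rewrite ler_wpM2l.
  by move: deltaE; rewrite expr2; lra.
exists delta => // S sgS TS.
(* The inverse of T tau on the kernel of P; the value 0 elsewhere is a placeholder. *)
have /choice[b bP] : forall x, exists y, P x = 0 -> P y = 0 /\ T tau y = x.
  move=> x; have [Px|Px] := eqVneq (P x) 0; last by exists 0 => Px0;
    rewrite Px0 eqxx in Px.
  by have [y Py yx] := Psurj _ _ (ltW tau0) Px; exists y.
have K1 : 1 <= 2 * (p + 1) by lra.
have bker x : P x = 0 -> P (b x) = 0 by move=> /bP[].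
have Tb x : P x = 0 -> T tau (b x) = x by move=> /bP[].
have bT x : P x = 0 -> b (T tau x) = x.
  move=> Px; have PTx : P (T tau x) = 0 by rewrite -TP ?(ltW tau0)// Px linear0.
  have Pd : P (b (T tau x) - x) = 0 by rewrite linearB Px bker// subrr.
  have := unstable _ _ (ltW tau0) Pd.
  by rewrite linearB Tb// subrr normr0 mulr0 normr_le0 subr_eq0 => /eqP.
have bstable x : P x = 0 -> `|b x| <= k0 * `|x|.
  move=> Px; apply: le_trans (unstable _ _ (ltW tau0) (bker _ Px)) _.
  by rewrite Tb// ler_wpM2r.
have Tstable x : `|T tau (P x)| <= k0 * `|P x|.
  by apply: le_trans (stable _ _ (ltW tau0)) _; rewrite ler_wpM2r.
have ST x : `|S tau x - T tau x| <= k0 * `|x|.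
  rewrite -deltaE.
  by apply: (yosida_close_semigroups sgT sgS TS (ltW delta0)
    (ltW tau0) M1 TM deltaM _ (ltW tau0)).
have TPtau x : T tau (P x) = P (T tau x) by rewrite TP// ltW.
have k0_ge0 := ltW k0_gt0; have k0p_le : k0 * (1 + p) <= 1 / 16 by rewrite k0p.
apply: (solvable_dichotomy sgS tau0 K1) => [f c fc|f x c B fc xB xf].
  exact: (bounded_solution_exists p0 Pp PP TPtau Tstable bker Tb bT bstable ST
    _ _ _ _ fc).
exact: (bounded_solution_bound p0 Pp PP TPtau Tstable bT bstable ST _ _ _ _
  fc xB xf).
Qed.
End Robustness.

(** * Transfer to the original scalars *)

Section Transfer.
Context {R : realType} {k : scalar_kind}.
Local Notation K := (scalar_field R k).
Variable X : completeNormedModType K.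
Local Notation XR := (realified X).
Implicit Types (T S : R -> {linear X -> X}) (A B : linear_operator X).

Lemma realified_ler (x y : X) c :
  (`|x| <= of_real c * `|y|) = (`|x : XR| <= c * `|y : XR|).
Proof. by rewrite -!realified_norm -of_realM ler_of_real. Qed.

Lemma continuous_linearP (f : {linear X -> X}) : continuous f <->
  exists2 M : R, 0 <= M & forall x, `|f x| <= of_real M * `|x|.
Proof.
rewrite -linear_bounded_continuous linear_boundedP; split.
  move=> [M [Mreal Mf]].
  pose N := real_part `|M|; have NE : of_real N = `|M| :=
    real_partK (normr_ge0 M).
  have N0 : 0 <= N by rewrite -(@ler_of_real _ k) of_real0 NE.
  exists (N + 1); first by rewrite addr_ge0.
  apply: Mf; apply: le_lt_trans (real_ler_norm Mreal) _.
  by rewrite -NE ltr_of_real ltrDl.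
move=> [M M0 fM].
exists (of_real M); split.
  by rewrite ger0_real// -of_real0 ler_of_real.
move=> r Mr x; apply: le_trans (fM x) _.
by rewrite ler_wpM2r// ltW.
Qed.

(** A name to which linearity over [R] can be attached, f itself being linear over [K]. *)
Definition realified_map (f : {linear X -> X}) : XR -> XR := f.

Let realified_map_linear f : linear (realified_map f).
Proof. by move=> a x y; rewrite /realified_map realified_scale linearP. Qed.

HB.instance Definition _ f :=
  GRing.isLinear.Build R XR XR *:%R (realified_map f) (@realified_map_linear f).

Local Notation "T ^R" := (fun t => realified_map (T t) : {linear XR -> XR})
  (at level 2, format "T ^R").

Lemma realified_semigroup T : C0_semigroup T -> strong_semigroup T^R.
Proof.
move=> [Tc T0 TD Tcv]; apply: strong_semigroupP => //.
- move=> t t0; have [M M0 TM] := (continuous_linearP (T t)).1 (Tc t t0).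
  by exists M => // x; have := TM x; rewrite realified_ler.
- by move=> x; apply/(@cvg_realified _ _ X); exact: Tcv.
Qed.

Lemma generates_generator T A x y : generator_of T A ->
  generates T^R x y <-> dom A x /\ A x = y.
Proof.
move=> TA; rewrite TA; rewrite cvg_realified.
have E (t : R) : 0 < t -> `|T^R t x - x - t *: (y : XR)| =
    t * `|(y : XR) - t^-1 *: (T^R t x - x)|.
  move=> t0; set d := T^R t x - x.
  rewrite (_ : d - _ = - (t *: ((y : XR) - t^-1 *: d))).
    by rewrite normrN normrZ gtr0_norm.
  by rewrite scalerBr scalerA mulfV ?gt_eqF// scale1r opprB.
split.
  move=> Txy; apply/cvgrPdist_le => e e0; near=> t.
  have t0 : 0 < t by near: t; exact: nbhs_right_gt.
  rewrite -of_realV -(realified_scale (t^-1) (T t x - x)).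
  rewrite -(ler_pM2l t0) -E// mulrC.
  by near: t; exact: Txy.
move=> /cvgrPdist_le Txy e e0; near=> t.
have t0 : 0 < t by near: t; exact: nbhs_right_gt.
rewrite E// mulrC ler_pM2r//.
rewrite (realified_scale (t^-1) (T t x - x)) of_realV.
by near: t; exact: Txy.
Unshelve. all: by end_near. Qed.


Lemma resolvent_generates T A mu x y : generator_of T A ->
  {in dom A &, injective (fun x => of_real mu *: x - A x)} ->
  generates T^R x (mu *: (x : XR) - y) ->
  resolvent A (of_real mu) y = x.
Proof.
move=> TA inj /(generates_generator _ _ TA)[Ax xy].
have {1}-> : y = (fun x => of_real mu *: x - A x) x.
  by rewrite /= xy realified_scale opprB addrC subrK.
by rewrite /resolvent pinvKV// inE.
Qed.

Lemma resolvent_injective T A : C0_semigroup T -> generator_of T A ->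
  exists mu0, forall mu, mu0 <= mu ->
    {in dom A &, injective (fun x => of_real mu *: x - A x)}.
Proof.
move=> /realified_semigroup sgT TA.
have [C C0 [mu0 mu0_gt0 TC]] := generates_resolvent sgT.
exists mu0 => mu mu0mu x x'; rewrite !inE => Ax Ax' xx'.
have [_ Tbd] := TC mu mu0mu.
have gx : generates T^R x (A x) by apply/(generates_generator _ _ TA).
have gx' : generates T^R x' (A x') by apply/(generates_generator _ _ TA).
have := generates_lin (-1) gx' gx; rewrite !scaleN1r => g.
have AE : - A x' + A x = of_real mu *: (- x' + x).
  by rewrite scalerDr scalerN -[of_real mu *: x](subrK (A x)) xx';
    lmod (scalar_field R k).
have : mu * `|- (x' : XR) + (x : XR)| <= C * `|0 : XR|.
  by apply: Tbd; rewrite subr0 realified_scale -AE.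
rewrite normr0 mulr0 pmulr_rle0; last exact: lt_le_trans mu0mu.
by rewrite normr_le0 addrC subr_eq0 => /eqP.
Qed.

Lemma yosida_distance_close T S A B delta : C0_semigroup T -> C0_semigroup S ->
  generator_of T A -> generator_of S B ->
  (yosida_distance A B < delta%:E)%E -> yosida_close T^R S^R delta.
Proof.
move=> sgT sgS TA SB.
have [mu1 injA] := resolvent_injective sgT TA.
have [mu2 injB] := resolvent_injective sgS SB.
rewrite /yosida_distance limf_esupE =>
  /ereal_inf_lt[_ [V [mu3 [_ V3]] <-]] Vdelta.
(* Neighbourhoods of infinity are given by a strict inequality, hence mu3 + 1. Beyond mu1 and mu2
   the values of [resolvent] are the true ones. *)
exists (Num.max (Num.max mu1 mu2) (mu3 + 1)) => mu z w v.
rewrite !ge_max => /andP[/andP[mu1mu mu2mu] mu3mu] gz gv.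
set y := mu *: z - w in gv *.
have Ry := resolvent_generates TA (injA _ mu1mu) gv.
have Rz : resolvent B (of_real mu) y = z.
  apply: (resolvent_generates SB (injB _ mu2mu)).
  by rewrite /y opprB addrC subrK.
have : (opnorm (fun x => (yosida A mu x - yosida B mu x)%R) < delta%:E)%E.
  apply: le_lt_trans Vdelta; apply: ereal_sup_ubound; exists mu => //.
  by apply: V3; lra.
move=> /ereal_inf_lt[_ [M [M0 AB] <-]]; rewrite lte_fin => Mdelta.
have := AB y; rewrite /yosida Ry Rz.
have yosidaE (a b c : X) :
    of_real mu ^+ 2 *: a - of_real mu *: c -
      (of_real mu ^+ 2 *: b - of_real mu *: c) =
    of_real (mu ^+ 2) *: (a - b).
  by rewrite (expr2 mu) of_realM -expr2; lmod (scalar_field R k).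
rewrite yosidaE.
rewrite realified_ler -(realified_scale (mu ^+ 2) ((v : X) - (z : X))).
rewrite normrZ ger0_norm ?sqr_ge0// => /le_trans; apply.
by rewrite ler_wpM2r// ltW.
Qed.

Lemma backwardK T (P : {linear X -> X}) t x :
  {in ker P &, injective (T t)} -> P x = 0 -> backward T P t (T t x) = x.
Proof. by move=> inj Px; rewrite /backward pinvKV// inE. Qed.

Lemma exponential_dichotomy_realified T : exponential_dichotomy T ->
  exists (P : {linear X -> X}) p N beta, [/\ 1 <= N, 0 < beta, 0 <= p,
    forall x : XR, `|realified_map P x| <= p * `|x| &
    dichotomy T^R (realified_map P) N beta].
Proof.
move=> [P [N [beta [[Pc PP] [N1 beta0] TP Tbij TN]]]].
have [p p0 Pp] := (continuous_linearP P).1 Pc.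
exists P, p, N, beta; split => //.
  by move=> x; rewrite -realified_ler.
split => //.
- move=> t x t0 Px; have [_ _ Tsurj] := Tbij t t0.
  by have [y Py yx] := Tsurj x Px; exists y.
- move=> t x t0; rewrite -realified_ler; have [stable _] := TN t t0.
  by apply: stable; exists x.
move=> t x t0 Px; rewrite -realified_ler; have [_ unstable] := TN t t0.
have [Tfun Tinj _] := Tbij t t0.
have := unstable (T t x) (Tfun x Px).
by rewrite (backwardK Tinj Px).
Qed.

Lemma realified_exponential_dichotomy S (Q : {linear XR -> XR}) q N beta :
  1 <= N -> 0 < beta -> 0 <= q -> dichotomy S^R Q N beta ->
  (forall x, `|Q x| <= q * `|x|) ->
  (forall (a : K) (x : X), Q (a *: x) = a *: (Q x : X)) ->
  exponential_dichotomy S.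
Proof.
move=> N1 beta0 q0 [QQ SQ Ssurj stable unstable] Qq Qa.
have Qlin : linear (Q : X -> X).
  by move=> a x y; rewrite -Qa; exact: (linearD Q).
pose QK : {linear X -> X} :=
  HB.pack (Q : X -> X) (GRing.isLinear.Build _ _ _ _ _ Qlin).
have S0 t x : 0 <= t -> Q x = 0 -> S t x = 0 -> x = 0.
  move=> t0 Qx Sx; apply/eqP; rewrite -(@normr_le0 _ XR).
  apply: le_trans (unstable t x t0 Qx) _.
  have -> : S^R t x = 0 by exact: Sx.
  by rewrite normr0 mulr0.
have Sinj t : 0 <= t -> {in ker QK &, injective (S t)}.
  move=> t0 x y; rewrite !inE => Qx Qy Sxy; apply/eqP; rewrite -subr_eq0;
    apply/eqP.
  apply: (S0 t) => //; last by rewrite linearB Sxy subrr.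
  by rewrite (linearB QK) Qx Qy subrr.
exists QK, N, beta; split => //.
- split => //; apply/continuous_linearP; exists q => // x.
  by rewrite realified_ler; exact: Qq.
- move=> t t0; split; last 2 first.
  + exact: Sinj.
  + by move=> x Qx; have [y Qy yx] := Ssurj t x t0 Qx; exists y.
  + move=> x Qx; have := SQ t x t0; rewrite Qx.
    by rewrite linear0 /ker /= => <-.
move=> t t0; split=> x.
  move=> [u _ <-]; rewrite realified_ler; exact: stable.
move=> Qx; have [y Qy yx] := Ssurj t x t0 Qx.
rewrite -yx [X in backward _ _ _ X](_ : _ = S t y)// backwardK//;
  last exact: Sinj.
by rewrite realified_ler; exact: unstable.
Qed.

End Transfer.

Theorem theorem3p2 (R : realType) (k : scalar_kind)
    (X : completeNormedModType (scalar_field R k))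
    (A : linear_operator X) (T : R -> {linear X -> X}) :
  C0_semigroup T -> generator_of T A -> exponential_dichotomy T ->
  exists delta : R, 0 < delta /\
    forall (B : linear_operator X) (S : R -> {linear X -> X}),
      C0_semigroup S -> generator_of S B ->
      (yosida_distance A B < delta%:E)%E ->
      exponential_dichotomy S.
Proof.
move=> sgT TA /exponential_dichotomy_realified
  [P [p [N [beta [N1 beta0 p0 Pp dichT]]]]].
have [delta delta0 robust] :=
  dichotomy_robust (realified_semigroup sgT) N1 beta0 p0 Pp dichT.
exists delta; split => // B S sgS SB AB.
have [Q [N' [beta' [N'1 beta'0 dichS Qq QJ]]]] :=
  robust _ (realified_semigroup sgS) (yosida_distance_close sgT sgS TA SB AB).
apply: (realified_exponential_dichotomy N'1 beta'0 _ dichS Qq) => [|a x].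
  by lra.
(* Multiplication by a is bounded and commutes with S, so commutation of Q with it is linearity over
   [K]. *)
pose J : {linear X -> X} := a \*: (idfun : {linear X -> X}).
apply: (QJ (realified_map J) (real_part `|a|)).
- by rewrite -(@ler_of_real _ k) of_real0 real_partK.
- move=> y; rewrite -realified_ler real_partK//.
  by rewrite /realified_map /= normrZ.
- by move=> t y t0; exact/esym/(linearZ_LR (S t)).
Qed.
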